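(* Let $E$ be a Polish space with Borel $\sigma$-algebra $\mathcal{B}$ and $(P_t)_{t\ge0}$ a measurable Markovian transition function on $(E,\mathcal{B})$ with the Feller property ($P_t$ maps bounded continuous functions to bounded continuous functions), with resolvent $R_\alpha f=\int_0^\infty e^{-\alpha t}P_tf\,dt$. Assume there exist a compact set $K\subset E$ and a probability measure $\nu$ such that $$\limsup_{t\to\infty}\frac1t\int_0^t\nu(P_s1_K)\,ds>\frac12.$$ Choose $t_n\nearrow\infty$ with $\frac1{t_n}\int_0^{t_n}\nu(P_s1_K)\,ds>\frac12$ for all $n$, let $\mu^K_n(f):=\frac1{t_n}\int_0^{t_n}\nu(P_s(1_Kf))\,ds$, let $\mu$ be a weak limit of a subsequence $(\mu^K_{n_k})_k$, fix $\alpha>0$, and define $m(f):=\mu(\alpha R_\alpha f)$ for positive measurable $f$. Then $m$ is almost invariant for $(P_t)_{t\ge0}$; hence there exists an invariant measure for $(P_t)_{t\ge0}$ which is absolutely continuous with respect to $m$.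
   Context: The family $(\mu^K_n)_n$ is tight, so such a weakly convergent subsequence exists. A finite positive measure $m$ is almost invariant if $m(f)=0$ implies $m(P_tf)=0$ for all $t>0$ and positive measurable $f$, and there exist $\delta\in[0,1)$ and $\phi:\mathcal{B}\to\mathbb{R}_+$ with $\lim_{m(A)\to0}\phi(A)=0$ such that $m(P_t1_A)\le\delta m(E)+\phi(A)$ for all $t>0$, $A\in\mathcal{B}$. An invariant measure is a nonzero finite positive measure $\eta$ with $\int P_tf\,d\eta=\int f\,d\eta$ for all $t>0$ and bounded measurable $f$. *)

(* Defs.v *)
From HB Require Import structures.
From mathcomp Require Import all_boot all_order all_algebra.
From mathcomp Require Import all_classical all_reals all_analysis.
From mathcomp Require Import measurable_realfun.
Set Implicit Arguments. Unset Strict Implicit. Unset Printing Implicit Defensive.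
Import Order.TTheory GRing.Theory Num.Theory.
Import numFieldNormedType.Exports.
Local Open Scope classical_set_scope.
Local Open Scope ring_scope.

Notation borelE E := (g_sigma_algebraType (@open E)).

Definition polish (R : realType) (E : ptopologicalType) : Prop :=
  (exists D : set E, countable D /\ closure D = setT) /\
  exists dist : E -> E -> R,
    (forall x y, 0 <= dist x y) /\
        (forall x y, dist x y = 0 <-> x = y) /\
        (forall x y, dist x y = dist y x) /\
        (forall x y z, dist x z <= dist x y + dist y z) /\
        (forall A : set E, open A <->
            (forall x, A x -> exists r : R, 0 < r /\ [set y | dist x y < r] `<=` A)) /\
        (forall u : nat -> E,
            (forall e : R, 0 < e -> exists N, forall n m, (N <= n)%N -> (N <= m)%N ->
                 dist (u n) (u m) < e) ->
            exists l : E, u @ \oo --> l).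


Section defs.
Context {R : realType} {E : ptopologicalType}.
Local Notation B := (borelE E).
Local Notation kernel := (R -> B -> probability B R).

Definition Pt (P : kernel) (t : R) (f : B -> \bar R) (x : B) : \bar R :=
  (\int[P t x]_y f y)%E.

Definition transition_function (P : kernel) : Prop :=
  (forall (x : B) (A : set B), measurable A -> P 0 x A = \d_x A) /\
  (forall s t : R, 0 <= s -> 0 <= t -> forall (x : B) (A : set B), measurable A ->
      P (s + t) x A = (\int[P s x]_y P t y A)%E) /\
  (forall A : set B, measurable A ->
      measurable_fun [set tx : R * B | 0 <= tx.1] (fun tx : R * B => P tx.1 tx.2 A)).

Definition feller (P : kernel) : Prop :=
  forall t : R, 0 <= t -> forall f : E -> R, continuous f ->
    (exists M : R, forall x, `|f x| <= M) ->
    continuous (fun x : E => fine (\int[P t x]_y (f y)%:E)%E).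

Definition resolvent (P : kernel) (alpha : R) (f : B -> \bar R) (x : B) : \bar R :=
  (\int[lebesgue_measure]_(t in `[0%R, +oo[) ((expR (- (alpha * t)))%:E * Pt P t f x))%E.

Definition muK (P : kernel) (nu : probability B R) (K : set B) (T : R)
    (f : B -> \bar R) : \bar R :=
  ((T^-1)%:E * \int[lebesgue_measure]_(s in `[0%R, T])
      \int[nu]_x Pt P s (fun y => (\1_K y)%:E * f y) x)%E.

Definition almost_invariant (P : kernel) (m : {measure set B -> \bar R}) : Prop :=
  (m setT < +oo)%E /\
  (forall f : B -> \bar R, measurable_fun setT f -> (forall x, 0 <= f x)%E ->
     (\int[m]_x f x = 0)%E -> forall t : R, 0 < t -> (\int[m]_x Pt P t f x = 0)%E) /\
  exists delta : R, 0 <= delta < 1 /\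
  exists phi : set B -> R,
    (forall A, measurable A -> 0 <= phi A) /\
    (forall eps : R, 0 < eps -> exists2 eta : R, 0 < eta &
        forall A, measurable A -> (m A < eta%:E)%E -> phi A < eps) /\
    (forall t : R, 0 < t -> forall A, measurable A ->
       (\int[m]_x P t x A <= delta%:E * m setT + (phi A)%:E)%E).

Definition invariant_measure (P : kernel) (eta : {measure set B -> \bar R}) : Prop :=
  (eta setT < +oo)%E /\ eta setT <> 0%E /\
  (forall t : R, 0 < t -> forall f : B -> R, measurable_fun setT f ->
     (exists M : R, forall x, `|f x| <= M) ->
     (\int[eta]_x Pt P t (fun y => (f y)%:E) x = \int[eta]_x (f x)%:E)%E).

End defs.

(* Main.v *)
Require Import Defs.
From HB Require Import structures.
From mathcomp Require Import all_boot all_order all_algebra.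
From mathcomp Require Import all_classical all_reals all_analysis.
From mathcomp Require Import measurable_realfun.
From mathcomp Require Import ring lra.
Set Implicit Arguments. Unset Strict Implicit. Unset Printing Implicit Defensive.
Import Order.TTheory GRing.Theory Num.Theory.
Import numFieldNormedType.Exports.
Local Open Scope classical_set_scope.
Local Open Scope ring_scope.

(* Write c := m(E) = mu(E) >= 1/2. The Cesaro averages of nu P_s have mass 1, dominate mu^K_n and are
   asymptotically invariant, so (Feller) a continuous partition of unity f0 + f1 + f2 = 1 satisfies
   m(P_t f0) + m(P_r f1) + m(f2) <= 1. With f0 = h0, f1 = (1 - h0) h1, f2 = (1 - h0)(1 - h1) and the
   density of continuous functions in L^1(m), every pair of Borel sets satisfies
     m(P_t A0) + m(P_r A1) + c <= 1 + m(P_r A0) + m(A0) + m(A1).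
   Suppose m(A1) < c/10 and m(P_r A1) > 9c/10 for some A1 and r. Since m P_r <= e^(alpha r) m, no A0 with
   m(A0) < e^(-alpha r) c/10 can satisfy m(P_t A0) > 9c/10: this would give 14c/5 < 1 + 3c/10. Whether or
   not such A1 and r exist, m is almost invariant with delta = 9/10. This covers the borderline case
   c = 1/2, where the simpler bound m(P_t A) <= m(A) + 1 - c is useless.

   For the invariant measure, take a limit Lambda of the Cesaro averages of m P_s along an ultrafilter:
   a P-invariant finitely additive set function, null on m-null sets. Its outer measure eta is the
   largest measure below Lambda; eta P_t <= Lambda forces eta P_t <= eta, hence equality since the
   masses agree, and almost invariance prevents eta from vanishing. *)

(** * Mixtures of measures and translation invariance *)

Section mixture.
Context d d' (Z : measurableType d) (Y : measurableType d') (R : realType).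
Variables (rho : {measure set Z -> \bar R}) (k : Z -> {measure set Y -> \bar R}).
Hypothesis mk : forall A, measurable A -> measurable_fun setT (k ^~ A).
Local Open Scope ereal_scope.

(** The binding of [mk] makes the definition carry the measurability of the kernel, on which the
    measure structure attached to it below depends. *)
Definition mixture (A : set Y) : \bar R := let _ := mk in \int[rho]_z k z A.

Let mixture0 : mixture set0 = 0.
Proof. by rewrite /mixture integral0_eq. Qed.

Let mixture_ge0 A : 0 <= mixture A.
Proof. exact: integral_ge0. Qed.

Let mixture_semi_sigma_additive : semi_sigma_additive mixture.
Proof.
move=> F mF tF mUF; rewrite [X in _ --> X](_ : _ = \int[rho]_z \sum_(n <oo) k z (F n)).
  rewrite integral_nneseries//; last by move=> n; exact: mk.
  apply: is_cvg_nneseries => n _ _; exact: integral_ge0.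
apply: eq_integral => z _; apply/esym/cvg_lim => //.
exact: measure_semi_sigma_additive.
Qed.

HB.instance Definition _ := isMeasure.Build _ _ _ mixture
  mixture0 mixture_ge0 mixture_semi_sigma_additive.

Import HBNNSimple.

Let integral_mixture_nnsfun (f : {nnsfun Y >-> R}) :
  \int[mixture]_y (f y)%:E = \int[rho]_z \int[k z]_y (f y)%:E.
Proof.
rewrite integralT_nnsfun sintegralE.
under [in RHS]eq_integral do rewrite integralT_nnsfun sintegralE.
rewrite ge0_integral_fsum//; last 2 first.
- by move=> r; apply: measurable_funeM; exact: mk.
- by move=> r z _; exact: nnsfun_mulemu_ge0.
apply: eq_fsbigr => r _.
have [r0|r0] := leP 0%R r; first by rewrite ge0_integralZl//; exact: mk.
(* A negative value is never taken, so its level set is empty and both sides vanish. *)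
rewrite preimage_nnfun0// measure0 mule0 integral0_eq// => z _.
by rewrite measure0 mule0.
Qed.

(** Linearity settles simple functions. Increasing simple approximations then give the general case
    by monotone convergence, applied to [mixture], to each [k z], and to [rho]. *)
Lemma integral_mixture (f : Y -> \bar R) : (forall y, 0 <= f y) ->
  measurable_fun setT f ->
  \int[mixture]_y f y = \int[rho]_z \int[k z]_y f y.
Proof.
move=> f0 mf; pose f_ := nnsfun_approx measurableT mf.
have f_f (nu : {measure set Y -> \bar R}) :
    \int[nu]_y (f_ n y)%:E @[n --> \oo] --> \int[nu]_y f y.
  rewrite [X in _ --> X](_ : _ = \int[nu]_y (limn (EFin \o f_^~ y))).
    apply: cvg_monotone_convergence => //.
    - by move=> n; exact/measurable_EFinP.
    - by move=> n y _; rewrite lee_fin.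
    - by move=> y _ a b ab; rewrite lee_fin; exact/lefP/nd_nnsfun_approx.
  by apply: eq_integral => y _; apply/esym/cvg_lim => //; exact: cvg_nnsfun_approx.
rewrite -(cvg_lim _ (f_f mixture))//; apply/cvg_lim => //.
rewrite (_ : (fun n => _) = (fun n => \int[rho]_z \int[k z]_y (f_ n y)%:E)); last first.
  by apply/funext => n; exact: integral_mixture_nnsfun.
rewrite [X in _ --> X](_ : _ = \int[rho]_z limn (fun n => \int[k z]_y (f_ n y)%:E)).
  apply: cvg_monotone_convergence => //.
  - move=> n; apply: measurable_fun_integral_kernel => //.
    + by move=> y; rewrite lee_fin.
    + exact/measurable_EFinP.
  - by move=> n z _; apply: integral_ge0 => y _; rewrite lee_fin.
  - move=> z _ a b ab; apply: ge0_le_integral => //.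
    + by move=> y _; rewrite lee_fin.
    + exact/measurable_EFinP.
    + exact/measurable_EFinP.
    + by move=> y _; rewrite lee_fin; exact/lefP/nd_nnsfun_approx.
by apply: eq_integral => z _; apply/esym/cvg_lim => //; exact: f_f.
Qed.

End mixture.

Section translation.
Context {R : realType}.
Local Open Scope ereal_scope.
Notation leb := (@lebesgue_measure R).

(** The pushforward of Lebesgue measure under the shift gives half-open intervals their length, so
    uniqueness of Lebesgue measure applies. *)
Lemma lebesgue_measure_translation (t : R) (A : set (measurableTypeR R)) :
  measurable A -> leb ((fun s => s + t)%R @^-1` A) = leb A.
Proof.
move=> mA; have mt : measurable_fun setT (fun s : measurableTypeR R => (s + t)%R : measurableTypeR R).
  exact: measurable_funD.
apply/esym.
apply: (@lebesgue_measure_unique R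
  (pushforward leb (fun s : measurableTypeR R => (s + t)%R : measurableTypeR R))) => //.
move=> X [[a b] _ <-]; 
have E : (fun s => s + t)%R @^-1` `]a, b] = `](a - t)%R, (b - t)%R]%classic.
  by apply/seteqP; split => x /=; rewrite !in_itv/= ltrBlDr lerBrDr.
change (leb `]a, b] = leb ((fun s => s + t)%R @^-1` `]a, b])); rewrite E.
rewrite !lebesgue_measure_itv/= !lte_fin ltrD2r; case: ifPn => // _.
by rewrite !EFinB -!EFinD; congr EFin; ring.
Qed.

Lemma ge0_integral_translation (t : R) (f : R -> \bar R) :
  (forall s, 0 <= f s) -> measurable_fun setT f ->
  \int[leb]_s f (s + t)%R = \int[leb]_s f s.
Proof.
move=> f0 mf; have mt : measurable_fun setT (fun s : measurableTypeR R => (s + t)%R : measurableTypeR R).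
  exact: measurable_funD.
rewrite -(@ge0_integral_pushforward _ _ _ _ _ _ mt leb setT f)//.
by apply: eq_measure_integral => A mA _; exact: lebesgue_measure_translation.
Qed.

End translation.

(** * Time averages of a transition function *)

Section finite_measure_of.
Context d (T : measurableType d) (R : realType) (m : {measure set T -> \bar R}).
Hypothesis m_fin : (m setT < +oo)%E.

(** Packages a proof of finiteness with [m], so that results on finite measures apply to a measure
    whose finiteness is only known through a hypothesis. *)
Definition finite_measure_of : set T -> \bar R := let _ := m_fin in m.
HB.instance Definition _ := Measure.on finite_measure_of.
HB.instance Definition _ := @Measure_isFinite.Build _ T R finite_measure_of
  (lty_fin_num_fun m_fin).
End finite_measure_of.

Section semigroup.
Context {R : realType} {E : ptopologicalType}.
Local Notation B := (borelE E).
Variable P : R -> B -> probability B R.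
Hypothesis hP : transition_function P.
Local Open Scope ereal_scope.
Implicit Types f g : B -> \bar R.
Notation leb := (@lebesgue_measure R).

(* Kernels are constrained at nonnegative times only, so times are read through their norm to get a
   kernel that is measurable on the whole line. *)
Lemma measurable_transition_norm A : measurable A ->
  measurable_fun setT (fun tx : R * B => P `|tx.1|%R tx.2 A).
Proof.
move=> mA; have [_ [_ /(_ _ mA) mP]] := hP.
have m0 : measurable [set tx : R * B | (0 <= tx.1)%R].
  rewrite [X in measurable X](_ : _ = fst @^-1` `[0%R, +oo[%classic); last first.
    by apply/seteqP; split => -[x y] /=; rewrite in_itv/= andbT.
  by rewrite -[_ @^-1` _]setTI; exact: measurable_fst.
have mg : measurable_fun setT (fun tx : R * B => (`|tx.1|%R, tx.2) : R * B).
  apply: measurable_fun_pair; last exact: measurable_snd.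
  by apply: measurableT_comp; [exact: normr_measurable|exact: measurable_fst].
by apply: (measurable_comp m0 _ mP mg) => _ [tx _ <-] /=.
Qed.

Lemma measurable_transition t A : (0 <= t)%R -> measurable A ->
  measurable_fun setT (fun x => P t x A).
Proof.
move=> t0 mA; have := measurable_transition_norm mA.
move/(measurable_fun_pair2 t) => /=.
by rewrite ger0_norm.
Qed.

Lemma Pt_ge0 t f : (forall x, 0 <= f x) -> forall x, 0 <= Pt P t f x.
Proof. by move=> f0 x; exact: integral_ge0. Qed.

Lemma measurable_Pt_norm f : (forall x, 0 <= f x) -> measurable_fun setT f ->
  measurable_fun setT (fun tx : R * B => Pt P `|tx.1|%R f tx.2).
Proof.
move=> f0 mf.
apply: (@measurable_fun_integral_kernel _ _ _ _ _ (fun tx : R * B => P `|tx.1|%R tx.2)) => //.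
exact: measurable_transition_norm.
Qed.

Lemma measurable_Pt t f : (0 <= t)%R -> (forall x, 0 <= f x) ->
  measurable_fun setT f -> measurable_fun setT (Pt P t f).
Proof.
move=> t0 f0 mf; have := measurable_Pt_norm f0 mf.
by move/(measurable_fun_pair2 t); rewrite /= ger0_norm.
Qed.

Lemma Pt0 f x : measurable_fun setT f -> Pt P 0 f x = f x.
Proof.
move=> mf; have [P0 _] := hP.
rewrite /Pt (@eq_measure_integral _ _ _ _ \d_x).
  by rewrite integral_dirac// diracT mul1e.
by move=> A mA _; exact: P0.
Qed.

Lemma PtD s t f x : (0 <= s)%R -> (0 <= t)%R -> (forall x, 0 <= f x) ->
  measurable_fun setT f -> Pt P (s + t)%R f x = Pt P s (Pt P t f) x.
Proof.
move=> s0 t0 f0 mf; have [_ [PD _]] := hP.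
have mPt := measurable_transition t0.
rewrite /Pt -(integral_mixture (P s x) mPt f0 mf).
by apply: eq_measure_integral => A mA _; exact: PD.
Qed.

Lemma Pt_indic t A x : measurable A -> Pt P t (fun y => (\1_A y)%:E) x = P t x A.
Proof. by move=> mA; rewrite /Pt integral_indic// setIT. Qed.

Lemma le_Pt t f g : (forall x, 0 <= f x) -> (forall x, f x <= g x) ->
  measurable_fun setT f -> measurable_fun setT g ->
  forall x, Pt P t f x <= Pt P t g x.
Proof. by move=> f0 fg mf mg x; apply: ge0_le_integral. Qed.

Lemma Pt_cst t (c : R) x : Pt P t (cst c%:E) x = c%:E.
Proof.
transitivity (c%:E * P t x setT); first exact: integral_cst.
by rewrite probability_setT mule1.
Qed.

Lemma PtDf t f g x : (forall x, 0 <= f x) -> (forall x, 0 <= g x) ->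
  measurable_fun setT f -> measurable_fun setT g ->
  Pt P t (fun y => f y + g y) x = Pt P t f x + Pt P t g x.
Proof. by move=> f0 g0 mf mg; rewrite /Pt ge0_integralD. Qed.

Section weighted.
Variables (w : R -> R) (w0 : forall s, (0 <= w s)%R).
Hypothesis mw : measurable_fun setT w.
Variable l : {finite_measure set B -> \bar R}.

Let weighted_kernel (tx : R * B) : {measure set B -> \bar R} :=
  mscale (NngNum (w0 tx.1)) (P `|tx.1|%R tx.2).

Let measurable_weighted_kernel A : measurable A ->
  measurable_fun setT (weighted_kernel ^~ A).
Proof.
move=> mA; apply: emeasurable_funM; last exact: measurable_transition_norm.
by apply/measurable_EFinP; apply: measurableT_comp => //; exact: measurable_fst.
Qed.

(** This is the measure with density [w] in time, the integral of [w s] times [l P_s]. An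
    exponential [w] produces the resolvent and a uniform [w] on [[0, T]] the Cesaro average, so both
    share the lemmas below. *)
Definition time_average : {measure set B -> \bar R} :=
  mixture (leb \x l) measurable_weighted_kernel.

Let integral_average f : (forall x, 0 <= f x) -> measurable_fun setT f ->
  \int[time_average]_x f x =
  \int[leb \x l]_tx ((w tx.1)%:E * Pt P `|tx.1|%R f tx.2).
Proof.
move=> f0 mf; rewrite integral_mixture//; apply: eq_integral => tx _.
by rewrite ge0_integral_mscale.
Qed.

Let measurable_integrand f : (forall x, 0 <= f x) -> measurable_fun setT f ->
  measurable_fun setT (fun tx : R * B => (w tx.1)%:E * Pt P `|tx.1|%R f tx.2).
Proof.
move=> f0 mf; apply: emeasurable_funM; last exact: measurable_Pt_norm.
by apply/measurable_EFinP; apply: measurableT_comp => //; exact: measurable_fst.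
Qed.

Let integrand_ge0 f : (forall x, 0 <= f x) ->
  forall tx : R * B, 0 <= (w tx.1)%:E * Pt P `|tx.1|%R f tx.2.
Proof. by move=> f0 tx; rewrite mule_ge0// ?lee_fin//; exact: Pt_ge0. Qed.

(** With space outermost the inner integral is a resolvent; [integral_time_average] keeps time
    outermost, as the shift arguments require. *)
Lemma integral_time_average1 f : (forall x, 0 <= f x) -> measurable_fun setT f ->
  \int[time_average]_x f x =
  \int[l]_x \int[leb]_s ((w s)%:E * Pt P `|s|%R f x).
Proof.
move=> f0 mf; rewrite integral_average// fubini_tonelli1//; last 2 first.
- exact: measurable_integrand.
- exact: integrand_ge0.
by rewrite fubini_tonelli//; [exact: measurable_integrand|exact: integrand_ge0].
Qed.

Lemma measurable_integral_Pt f : (forall x, 0 <= f x) -> measurable_fun setT f ->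
  measurable_fun setT (fun s : R => \int[l]_x Pt P `|s|%R f x).
Proof.
move=> f0 mf; apply: (@measurable_fun_fubini_tonelli_F _ _ _ _ _ l
  (fun tx : R * B => Pt P `|tx.1|%R f tx.2)).
- exact: measurable_Pt_norm.
- by move=> tx; exact: Pt_ge0.
Qed.

Lemma integral_time_average f : (forall x, 0 <= f x) -> measurable_fun setT f ->
  \int[time_average]_x f x =
  \int[leb]_s ((w s)%:E * \int[l]_x Pt P `|s|%R f x).
Proof.
move=> f0 mf; rewrite integral_average// fubini_tonelli1//; last 2 first.
- exact: measurable_integrand.
- exact: integrand_ge0.
apply: eq_integral => s _; rewrite /fubini_F/= ge0_integralZl//.
- by apply: measurable_Pt.
- by move=> x _; exact: Pt_ge0.
- by rewrite lee_fin.
Qed.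

End weighted.

End semigroup.

(** * Action of the semigroup on time averages *)

Section shift.
Context {R : realType} {E : ptopologicalType}.
Local Notation B := (borelE E).
Variable P : R -> B -> probability B R.
Hypothesis hP : transition_function P.
Local Open Scope ereal_scope.
Notation leb := (@lebesgue_measure R).

(** Applying [P_t] replaces [P_s] by [P_(s + t)]; translation invariance of Lebesgue measure moves
    the delay onto the weight. *)
Lemma integral_time_average_Pt (w : R -> R) (w0 : forall s, (0 <= w s)%R)
    (mw : measurable_fun setT w) (l : {finite_measure set B -> \bar R}) t f :
  (forall s, (s < 0)%R -> w s = 0%R) -> (0 <= t)%R ->
  (forall x, 0 <= f x) -> measurable_fun setT f ->
  \int[time_average hP w0 mw l]_x Pt P t f x =
  \int[leb]_s ((w (s - t))%:E * \int[l]_x Pt P `|s|%R f x).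
Proof.
move=> wN t0 f0 mf; rewrite (integral_time_average hP w0 mw l (Pt_ge0 P t f0) (measurable_Pt hP t0 f0 mf)).
rewrite -[RHS](@ge0_integral_translation _ t); last 2 first.
- by move=> s; rewrite mule_ge0 ?lee_fin// integral_ge0// => x _; exact: Pt_ge0.
- apply: emeasurable_funM; last exact: measurable_integral_Pt.
  by apply/measurable_EFinP; apply: measurableT_comp => //; exact: measurable_funB.
apply: eq_integral => s _; rewrite addrK.
(* At negative [s] the times [|s| + t] and [|s + t|] differ, but there the weight is zero. *)
have [s0|s0] := ltP s 0%R; first by rewrite (wN s s0) !mul0e.
rewrite (ger0_norm s0) (ger0_norm (addr_ge0 s0 t0)); congr (_ * _).
by apply: eq_integral => x _; rewrite -(PtD hP).
Qed.

Section exponential.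
Variables (alpha : R) (a0 : (0 < alpha)%R) (l : {finite_measure set B -> \bar R}).

Definition exponential_average : {measure set B -> \bar R} :=
  time_average hP (exponential_pdf_ge0 (ltW a0)) (measurable_exponential_pdf alpha) l.
Local Notation m := exponential_average.

Lemma integral_exponential_average f : (forall x, 0 <= f x) ->
  measurable_fun setT f ->
  \int[m]_x f x = \int[l]_x (alpha%:E * resolvent P alpha f x).
Proof.
move=> f0 mf; rewrite integral_time_average1//; apply: eq_integral => x _.
rewrite /resolvent [in RHS]integral_mkcond -ge0_integralZl//; last 3 first.
- apply/(measurable_restrictT _ _).1 => //.
  apply: (@eq_measurable_fun _ _ _ _ _ (fun t => (expR (- (alpha * t)))%:E * Pt P `|t|%R f x)).
    move=> t; rewrite inE/= in_itv/=.
    by rewrite andbT => t0; rewrite ger0_norm.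
  apply: measurable_funTS; apply: emeasurable_funM.
    apply/measurable_EFinP; apply: measurableT_comp => //.
    by apply: measurableT_comp => //; exact: measurable_funM.
  exact: (measurable_fun_pair1 x (measurable_Pt_norm hP f0 mf)).
- move=> t _; rewrite patchE; case: ifPn => // _.
  by rewrite mule_ge0// ?lee_fin ?expR_ge0//; exact: Pt_ge0.
- by rewrite lee_fin ltW.
apply: eq_integral => t _; rewrite /exponential_pdf !patchE.
case: ifPn; last by rewrite mule0 mul0e.
rewrite inE/= in_itv/= andbT => t0.
by rewrite ger0_norm// mulNr EFinM muleA.
Qed.

Lemma exponential_average_setT : m setT = l setT.
Proof.
rewrite -[LHS]mul1e -integral_cst//= integral_time_average//=.
under eq_integral.
  move=> s _; rewrite (_ : integral _ _ _ = l setT); last first.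
    rewrite -[RHS]mul1e -integral_cst//=.
    by apply: eq_integral => x _; exact: Pt_cst.
  over.
rewrite ge0_integralZr//=; last 2 first.
- by apply/measurable_EFinP; exact: measurable_exponential_pdf.
- by move=> s _; rewrite lee_fin exponential_pdf_ge0// ltW.
by rewrite integral_exponential_pdf// mul1e.
Qed.

(** Delaying the exponential density by [t] kills it before time [t] and multiplies it by
    [e^(alpha t)] afterwards. Hence [m P_t] is dominated by a multiple of [m]. *)
Lemma integral_exponential_average_Pt t f : (0 <= t)%R -> (forall x, 0 <= f x) ->
  measurable_fun setT f ->
  \int[m]_x Pt P t f x <= (expR (alpha * t))%:E * \int[m]_x f x.
Proof.
move=> t0 f0 mf; rewrite integral_time_average_Pt//; last first.
  by move=> s s0; exact: lt0_exponential_pdf.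
have mG := measurable_integral_Pt hP l f0 mf.
have G0 s : 0 <= \int[l]_x Pt P `|s|%R f x.
  by apply: integral_ge0 => x _; exact: Pt_ge0.
rewrite [in leRHS]integral_time_average// -ge0_integralZl//; last 2 first.
- apply: emeasurable_funM => //.
  by apply/measurable_EFinP; exact: measurable_exponential_pdf.
- by move=> s _; rewrite mule_ge0// lee_fin exponential_pdf_ge0// ltW.
apply: ge0_le_integral => //.
- by move=> s _; rewrite mule_ge0// lee_fin exponential_pdf_ge0// ltW.
- apply: emeasurable_funM => //; apply/measurable_EFinP.
  apply: measurableT_comp; first exact: measurable_exponential_pdf.
  exact: measurable_funB.
- apply: emeasurable_funM => //; apply: emeasurable_funM => //.
  by apply/measurable_EFinP; exact: measurable_exponential_pdf.
move=> s _; rewrite muleA -EFinM; apply: lee_wpmul2r => //; rewrite lee_fin.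
have [st|st] := ltP s t.
  rewrite lt0_exponential_pdf ?subr_lt0//.
  by rewrite mulr_ge0 ?expR_ge0// exponential_pdf_ge0// ltW.
rewrite !exponential_pdfE ?subr_ge0//; last exact: le_trans st.
rewrite mulrCA ler_pM2l// -expRD le_eqVlt; apply/orP; left; apply/eqP.
by congr expR; ring.
Qed.

End exponential.

Section cesaro.
Variables (T : R) (T0 : (0 < T)%R) (l : {finite_measure set B -> \bar R}).

Let w (s : R) : R := (T^-1 * \1_`[0%R, T] s)%R.
Let w0 s : (0 <= w s)%R.
Proof. by rewrite mulr_ge0// invr_ge0 ltW. Qed.
Let mw : measurable_fun setT w.
Proof. exact: measurable_funM. Qed.

Definition cesaro_average : {measure set B -> \bar R} := time_average hP w0 mw l.

Let integral_unif (D : set R) (G : R -> \bar R) : (forall s, 0 <= G s) ->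
  measurable_fun setT G -> measurable D ->
  \int[leb]_s ((T^-1 * \1_D s)%:E * G s) = (T^-1)%:E * \int[leb]_(s in D) G s.
Proof.
move=> G0 mG mD; rewrite [in RHS]integral_mkcond -ge0_integralZl//; last 3 first.
- by apply/(measurable_restrictT _ _).1 => //; exact: measurable_funTS.
- by move=> s _; rewrite patchE; case: ifPn.
- by rewrite lee_fin invr_ge0 ltW.
apply: eq_integral => s _; rewrite patchE indicE.
by case: (s \in D); rewrite ?mulr1// mulr0 mul0e mule0.
Qed.

Let G0 f : (forall x, 0 <= f x) -> forall s : R, 0 <= \int[l]_x Pt P `|s|%R f x.
Proof. by move=> f0 s; apply: integral_ge0 => x _; exact: Pt_ge0. Qed.

Lemma integral_cesaro_average f : (forall x, 0 <= f x) -> measurable_fun setT f ->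
  \int[cesaro_average]_x f x =
  (T^-1)%:E * \int[leb]_(s in `[0%R, T]) \int[l]_x Pt P s f x.
Proof.
move=> f0 mf; rewrite integral_time_average//.
rewrite (integral_unif (G0 f0) (measurable_integral_Pt hP l f0 mf) (measurable_itv _)).
apply: congr1.
apply: eq_integral => s.
rewrite inE/= in_itv/= => /andP[s0 _].
by rewrite (ger0_norm s0).
Qed.

Lemma cesaro_average_setT : cesaro_average setT = l setT.
Proof.
rewrite -[LHS]mul1e -integral_cst//= integral_cesaro_average//=.
under eq_integral.
  move=> s _; rewrite (_ : integral _ _ _ = l setT); last first.
    rewrite -[RHS]mul1e -integral_cst//=.
    by apply: eq_integral => x _; exact: Pt_cst.
  over.
rewrite integral_cst//= lebesgue_measure_itv/= lte_fin T0 sube0.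
by rewrite muleCA -EFinM mulVf ?mule1// gt_eqF.
Qed.

(** The shifted window [[t, T + t]] leaves [[0, T]] only through []T, T + t]], of length [t], where
    the integrand is at most the mass of [l]. *)
Lemma integral_cesaro_average_Pt t f : (0 <= t)%R ->
  (forall x, 0 <= f x) -> (forall x, f x <= 1) -> measurable_fun setT f ->
  \int[cesaro_average]_x Pt P t f x <=
  \int[cesaro_average]_x f x + (T^-1 * t)%:E * l setT.
Proof.
move=> t0 f0 f1 mf; rewrite integral_time_average_Pt//; last first.
  by move=> s s0; rewrite /w indicE memNset ?mulr0//= in_itv/= leNgt s0.
rewrite [in leRHS]integral_time_average//.
have mG := measurable_integral_Pt hP l f0 mf.
set G := fun s : R => \int[l]_x Pt P `|s|%R f x.
have G1 s : G s <= l setT.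
  rewrite -[leRHS]mul1e -integral_cst//; apply: ge0_le_integral => //.
  - by move=> x _; exact: Pt_ge0.
  - exact: measurable_Pt.
  - by move=> x _; rewrite -[leRHS](Pt_cst P `|s|%R 1%R x); apply: le_Pt.
(* The error is written as an integral over the excess window, which reduces the claim to a
   comparison of integrands. *)
have -> : (T^-1 * t)%:E * l setT = \int[leb]_s ((T^-1 * \1_`]T, (T + t)%R] s)%:E * l setT).
  rewrite integral_unif//.
  rewrite integral_cst//= lebesgue_measure_itv/= lte_fin ltrDl.
  rewrite EFinM -muleA; congr (_ * _); rewrite muleC; case: ltgtP t0 => // [t0 _|<- _].
    by rewrite -EFinB addrAC subrr add0r.
  by [].
rewrite -ge0_integralD//; last 4 first.
- by move=> s _; rewrite mule_ge0// ?lee_fin//; exact: G0.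
- by apply: emeasurable_funM => //; exact/measurable_EFinP.
- by move=> s _; rewrite mule_ge0// lee_fin mulr_ge0// invr_ge0 ltW.
- by apply: emeasurable_funM => //; apply/measurable_EFinP; exact: measurable_funM.
apply: ge0_le_integral => //.
- by move=> s _; rewrite mule_ge0// ?lee_fin//; exact: G0.
- apply: emeasurable_funM => //; apply/measurable_EFinP.
  by apply: measurableT_comp => //; exact: measurable_funB.
- apply: emeasurable_funD; apply: emeasurable_funM => //; apply/measurable_EFinP => //.
  exact: measurable_funM.
move=> s _; rewrite /w !indicE !mem_setE !in_itv/=.
have [|_] := boolP (0 <= s - t <= T)%R; last first.
  rewrite mulr0 mul0e adde_ge0// mule_ge0 ?lee_fin ?mulr_ge0 ?invr_ge0 ?(ltW T0)//.
  exact: G0.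
move=> /andP[st sT]; have s0 : (0 <= s)%R by rewrite (le_trans t0)// -subr_ge0.
rewrite s0/= -lerBlDr sT andbT.
have [sT'|sT'] := leP s T.
  by rewrite mulr0 mul0e adde0.
rewrite mulr0 mul0e add0e; apply: lee_wpmul2l; last exact: G1.
by rewrite lee_fin mulr1 invr_ge0 ltW.
Qed.

End cesaro.

End shift.

(** * Passing to the weak limit *)

Lemma continuous_borelE_measurable {R : realType} {E : ptopologicalType} (f : E -> R) :
  continuous f -> measurable_fun setT (f : borelE E -> R).
Proof.
move=> cf; apply: (measurability _ (RGenOInfty.measurableE R)) => //.
move=> /= _ [_ [a ->] <-]; rewrite setTI; apply: sub_sigma_algebra.
by move/continuousP : cf; apply; exact: interval_open.
Qed.

Section weak_limit.
Context {R : realType} {E : ptopologicalType}.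
Local Notation B := (borelE E).
Variable P : R -> B -> probability B R.
Hypothesis hP : transition_function P.
Hypothesis fP : feller P.
Variables (K : set B) (mK : measurable K) (nu : probability B R).
Variables (mu : {finite_measure set B -> \bar R}) (T : nat -> R).
Hypotheses (T0 : forall n, (0 < T n)%R) (Ty : T @ \oo --> +oo%R).
Hypothesis cvg_muK : forall f : E -> R, continuous f ->
  (exists M : R, forall x, `|f x| <= M) ->
  (fun n => muK P nu K (T n) (fun y => (f y)%:E)) @ \oo --> (\int[mu]_x (f x)%:E)%E.
Local Open Scope ereal_scope.

Lemma muK_le_cesaro (S : R) (S0 : (0 < S)%R) (f : B -> \bar R) : (forall x, 0 <= f x) ->
  measurable_fun setT f ->
  muK P nu K S f <= \int[cesaro_average hP S0 nu]_x f x.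
Proof.
move=> f0 mf; have f'0 x : 0 <= (\1_K x)%:E * f x.
  by rewrite mule_ge0// lee_fin.
have mf' : measurable_fun setT (fun x => (\1_K x)%:E * f x).
  by apply: emeasurable_funM => //; exact/measurable_EFinP.
rewrite /muK -(integral_cesaro_average hP S0 nu f'0 mf').
apply: ge0_le_integral => // x _; rewrite -[leRHS]mul1e lee_wpmul2r// lee_fin.
by rewrite indicE; case: (_ \in _).
Qed.

(** The Feller property enters here: [P_t f] is again bounded and continuous, so weak convergence
    can be tested on it. *)
Lemma muK_cvg_Pt (t : R) (f : E -> R) : (0 <= t)%R -> continuous f ->
  (forall x, (0 <= f x <= 1)%R) ->
  (fun n => muK P nu K (T n) (Pt P t (EFin \o f))) @ \oo -->
  \int[mu]_x Pt P t (EFin \o f) x.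
Proof.
move=> t0 cf f01.
have mf : measurable_fun setT (EFin \o f : B -> \bar R).
  by apply/measurable_EFinP; exact: continuous_borelE_measurable.
have f0 x : 0 <= (EFin \o f) x by rewrite lee_fin; case/andP : (f01 x).
have f1 x : (EFin \o f) x <= cst 1%:E x by rewrite lee_fin; case/andP : (f01 x).
have P0 x := Pt_ge0 P t f0 x.
have P1 x : Pt P t (EFin \o f) x <= 1.
  by rewrite -[leRHS](Pt_cst P t 1%R x); apply: le_Pt.
(* Weak convergence is stated for real functions; since [P_t f] lies between 0 and 1, passing
   through [fine] changes nothing. *)
have PE : (fun x => (fine (Pt P t (EFin \o f) x))%:E) = Pt P t (EFin \o f).
  apply/funext => x; rewrite fineK// ge0_fin_numE//.
  by rewrite (le_lt_trans (P1 x))// ltry.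
suff: (fun n => muK P nu K (T n) (fun x => (fine (Pt P t (EFin \o f) x))%:E)) @ \oo -->
    \int[mu]_x (fine (Pt P t (EFin \o f) x))%:E by rewrite PE.
apply: (cvg_muK (f := fun x => fine (Pt P t (EFin \o f) x))).
  apply: fP => //; exists 1%R => x.
  by have /andP[? ?] := f01 x; rewrite ger0_norm.
exists 1%R => x; rewrite ger0_norm ?fine_ge0//.
by rewrite -lee_fin (congr1 (fun h => h x) PE).
Qed.

(* The full Cesaro averages need not be tight, but they have mass 1, dominate muK and are asymptotically
   invariant; summing over a partition of unity is what survives of them in the limit. *)
Lemma weak_limit_partition (f0 f1 f2 : E -> R) (t0 t1 t2 : R) :
  continuous f0 -> continuous f1 -> continuous f2 ->
  (forall x, (0 <= f0 x)%R) -> (forall x, (0 <= f1 x)%R) -> (forall x, (0 <= f2 x)%R) ->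
  (forall x, (f0 x + f1 x + f2 x = 1)%R) ->
  (0 <= t0)%R -> (0 <= t1)%R -> (0 <= t2)%R ->
  \int[mu]_x Pt P t0 (EFin \o f0) x + \int[mu]_x Pt P t1 (EFin \o f1) x +
  \int[mu]_x Pt P t2 (EFin \o f2) x <= 1.
Proof.
move=> c0 c1 c2 p0 p1 p2 f1E t00 t10 t20.
have b0 x : (0 <= f0 x <= 1)%R by have := f1E x; have := p0 x; have := p1 x; have := p2 x; lra.
have b1 x : (0 <= f1 x <= 1)%R by have := f1E x; have := p0 x; have := p1 x; have := p2 x; lra.
have b2 x : (0 <= f2 x <= 1)%R by have := f1E x; have := p0 x; have := p1 x; have := p2 x; lra.
have I0 t (f : E -> R) : (forall x, (0 <= f x <= 1)%R) -> 0 <= \int[mu]_x Pt P t (EFin \o f) x.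
  by move=> f01; apply: integral_ge0 => x _; apply: Pt_ge0 => y; rewrite lee_fin; case/andP: (f01 y).
have mE (f : E -> R) : continuous f -> measurable_fun setT (EFin \o f : B -> \bar R).
  by move=> cf; apply/measurable_EFinP; exact: continuous_borelE_measurable.
have cvg_sum := cvgeD (ge0_adde_def (adde_ge0 (I0 t0 f0 b0) (I0 t1 f1 b1)) (I0 t2 f2 b2))
  (cvgeD (ge0_adde_def (I0 t0 f0 b0) (I0 t1 f1 b1))
    (muK_cvg_Pt t00 c0 b0) (muK_cvg_Pt t10 c1 b1)) (muK_cvg_Pt t20 c2 b2).
have nu1 : (nu : {finite_measure set B -> \bar R}) setT = 1 by exact: probability_setT.
(* Each of the three terms is at most the Cesaro average of its function plus an error [t_i / T n].
   The averages add up to 1, and the total error falls below [e] for large [n]. *)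
apply/lee_addgt0Pr => e e0; apply: (cvge_to_le (cvg_sum _ _)); near=> n.
have step t (f : E -> R) : (0 <= t)%R -> continuous f -> (forall x, (0 <= f x <= 1)%R) ->
    muK P nu K (T n) (Pt P t (EFin \o f)) <=
    \int[cesaro_average hP (T0 n) nu]_x (EFin \o f) x + ((T n)^-1 * t)%:E.
  move=> tp cf f01; have f0' (x : B) : 0 <= (EFin \o f) x by rewrite lee_fin; case/andP : (f01 x).
  have f1' (x : B) : (EFin \o f) x <= 1 by rewrite lee_fin; case/andP : (f01 x).
  apply: (le_trans (muK_le_cesaro (T0 n) (Pt_ge0 P t f0') (measurable_Pt hP tp f0' (mE _ cf)))).
  apply: (le_trans (integral_cesaro_average_Pt hP (T0 n) nu tp f0' f1' (mE _ cf))).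
  by rewrite nu1 mule1.
apply: (le_trans (leeD (leeD (step _ _ t00 c0 b0) (step _ _ t10 c1 b1)) (step _ _ t20 c2 b2))).
set ces := cesaro_average _ _ _.
have -> : 1 = \int[ces]_x (EFin \o f0) x + \int[ces]_x (EFin \o f1) x + \int[ces]_x (EFin \o f2) x.
  rewrite -ge0_integralD//; [|by move=> x _; rewrite lee_fin|exact: mE
    |by move=> x _; rewrite lee_fin|exact: mE].
  rewrite -ge0_integralD//; first last.
  - exact: mE.
  - by move=> x _; rewrite lee_fin.
  - by apply: emeasurable_funD; exact: mE.
  - by move=> x _; rewrite adde_ge0//= lee_fin.
  rewrite (_ : (fun x => _) = cst 1); last by apply/funext => x /=; rewrite -!EFinD f1E.
  by rewrite integral_cst// mul1e cesaro_average_setT nu1.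
rewrite (addeACA (\int[ces]_x (EFin \o f0) x)) (addeACA (_ + _)); apply: leeD2l.
rewrite -!EFinD lee_fin -!mulrDr mulrC.
rewrite ler_pdivrMr// mulrC -ler_pdivrMr//.
near: n; move/cvgryPge : Ty; exact.
Unshelve. all: by end_near. Qed.

End weak_limit.

(** * Density of continuous functions in L1 *)

Section polish_topology.
Context {R : realType} {E : ptopologicalType}.
Hypothesis pE : polish R E.

(** Balls of half the distance separate two points. This serves to show that the compact set [K] is
    closed, hence Borel. *)
Lemma polish_hausdorff : hausdorff_space E.
Proof.
have [_ [dist [d0 [d_eq0 [dC [dT [dO _]]]]]]] := pE.
have ball_open x (r : R) : open [set y | dist x y < r].
  apply/dO => y /= xy; exists (r - dist x y); rewrite subr_gt0; split => // z /=.
  by rewrite ltrBrDl; exact: le_lt_trans.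
rewrite open_hausdorff => x y xy.
have dxy : 0 < dist x y.
  by rewrite lt_def d0 andbT; apply: contra xy => /eqP /d_eq0 ->.
have dxx z : dist z z = 0 by apply/d_eq0.
exists ([set z | dist x z < dist x y / 2], [set z | dist y z < dist x y / 2]).
  by rewrite !inE/= !dxx divr_gt0.
split => //=; apply/eqP/seteqP; split => // z [/= xz yz].
have := dT x z y; rewrite (dC z y) leNgt; case/negP.
by lra.
Qed.

(** The approximants are [min(1, n d(x))] with [d] the distance to the complement of [U], which is
    1-Lipschitz and positive exactly on [U]. *)
Lemma polish_open_approx (U : set E) : open U -> exists h : nat -> E -> R,
  [/\ forall n, continuous (h n), forall n x, 0 <= h n x <= 1 &
      forall x, h n x @[n --> \oo] --> (\1_U x : R)].
Proof.
have [_ [dist [d0 [d_eq0 [dC [dT [dO _]]]]]]] := pE.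
(* The whole space is set apart, since the distance to its complement would be the infimum of an
   empty set. *)
move=> oU; have [UT|] := pselect (U = setT).
  exists (fun _ => cst 1); split.
  - by move=> n x; exact: cst_continuous.
  - by move=> n x; rewrite ler01 lexx.
  - by move=> x; rewrite indicE UT in_setT; exact: cvg_cst.
rewrite -setC0 => /eqP; rewrite -(inj_eq (can_inj (@setCK _))) setCK => /set0P[z0 Uz0].
pose D x := [set dist x y | y in ~` U].
have D_inf x : has_inf (D x).
  by split; [exists (dist x z0), z0|exists 0 => _ [y _ <-]].
pose phi x := inf (D x).
have phi_lip x y : phi x <= dist x y + phi y.
  rewrite -lerBlDl; apply: lb_le_inf; first by case: (D_inf y).
  move=> _ [z Uz <-]; rewrite lerBlDl (le_trans _ (dT x y z))//.
  by apply: ge_inf; [by case: (D_inf x)|exists z].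
have phi0 x : 0 <= phi x by apply: lb_le_inf; [by case: (D_inf x)|move=> _ [y _ <-]].
have ball_open x (r : R) : open [set y | dist x y < r].
  apply/dO => y /= xy; exists (r - dist x y); rewrite subr_gt0; split => // z /=.
  by rewrite ltrBrDl; exact: le_lt_trans.
have dxx z : dist z z = 0 by apply/d_eq0.
have phi_cont : continuous phi.
  move=> x; apply/cvgrPdist_lt => e e0.
  apply: filterS (open_nbhs_nbhs (conj (ball_open x e) _)); last by rewrite /= dxx.
  move=> y /= xy; rewrite ltr_norml; have := phi_lip x y; have := phi_lip y x.
  by rewrite (dC y x); lra.
exists (fun n x => Num.min 1 (n%:R * phi x)); split.
- move=> n x; apply: (@continuous_min _ _ (cst 1) (fun x => n%:R * phi x)).
    exact: cst_continuous.
  by apply: continuousM; [exact: cst_continuous|exact: phi_cont].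
- by move=> n x; rewrite le_min ler01 mulr_ge0//= ge_min lexx.
- move=> x; rewrite indicE; have [|] := boolP (x \in U); rewrite ?inE ?notin_setE => Ux.
    have [r [r0 xrU]] := (dO U).1 oU _ Ux.
    have rphi : r <= phi x.
      apply: lb_le_inf; first by case: (D_inf x).
      by move=> _ [y Uy <-]; rewrite leNgt; apply/negP => /xrU.
    apply: cvg_near_cst; near=> n; apply/min_idPl.
    rewrite -ler_pdivrMr ?(lt_le_trans r0)//; near: n; exact: nbhs_infty_ger.
  suff -> : phi x = 0 by under eq_fun do rewrite mulr0 min_r//; exact: cvg_cst.
  apply/eqP; rewrite eq_le phi0 andbT -(dxx x).
  by apply: ge_inf; [by case: (D_inf x)|exists x].
Unshelve. all: by end_near. Qed.

Local Open Scope ereal_scope.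
Local Notation B := (borelE E).

Section density.
Variable m : {finite_measure set B -> \bar R}.

(** These sets are shown to form a sigma-algebra containing the open sets, hence to include every
    Borel set. *)
Let L1_approx (A : set B) := measurable A /\ forall e : R, (0 < e)%R ->
  exists h : E -> R, [/\ continuous h, forall x, (0 <= h x <= 1)%R &
    \int[m]_x (`|h x - \1_A x|%:E) <= e%:E].

Let measurable_dist (h : E -> R) (A : set B) : continuous h -> measurable A ->
  measurable_fun setT (fun x : B => (`|h x - \1_A x|%:E)).
Proof.
move=> ch mA; apply/measurable_EFinP; apply: measurableT_comp => //.
by apply: measurable_funB => //; exact: continuous_borelE_measurable.
Qed.

Let L1_approx_open U : open U -> L1_approx U.
Proof.
move=> oU; have mU : measurable (U : set B) by exact: sub_sigma_algebra.
split => // e e0; have [h [ch h01 hU]] := polish_open_approx oU.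
have [] := @dominated_convergence _ _ _ m setT measurableT
  (fun n => EFin \o h n) (EFin \o \1_U) (cst 1).
- by move=> n; apply/measurable_EFinP; exact: continuous_borelE_measurable.
- by apply/measurable_EFinP.
- by apply: aeW => x _; apply: cvg_EFin; [exact: nearW|exact: hU].
- by apply: finite_measure_integrable_cst.
- apply: aeW => x n _ /=; rewrite lee_fin; have /andP[h0 h1] := h01 n x.
  by rewrite ger0_norm.
move=> _ + _ => /fine_cvgP[fin /cvgrPdist_lt /(_ _ e0) small].
near \oo => n; exists (h n); split => //.
have I0 : 0 <= \int[m]_x `|h n x - \1_U x|%:E by exact: integral_ge0.
have If : \int[m]_x (`|h n x - \1_U x|%:E) \is a fin_num by near: n.
rewrite -(fineK If) lee_fin ltW// -[ltLHS]ger0_norm ?fine_ge0// -normrN -sub0r.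
by near: n.
Unshelve. all: by end_near. Qed.

Let L1_approxC A : L1_approx A -> L1_approx (~` A).
Proof.
move=> [mA Ah]; split; first exact: measurableC.
move=> e /Ah[h [ch h01 he]]; exists (fun x => 1 - h x)%R; split.
- by move=> x; apply: continuousB; [exact: cst_continuous|exact: ch].
- by move=> x; have := h01 x; lra.
- rewrite (le_trans _ he)//; rewrite le_eqVlt; apply/orP; left; apply/eqP.
  apply: eq_integral => x _; rewrite !indicE in_setC -normrN.
  by congr (`|_|%:E); case: (_ \in _) => /=; lra.
Qed.

(** The maximum of two approximants serves for the union: its pointwise error is at most the sum of
    the two errors. *)
Let L1_approxU A A' : L1_approx A -> L1_approx A' -> L1_approx (A `|` A').
Proof.
move=> [mA Ah] [mA' Ah']; split; first exact: measurableU.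
move=> e e0; have e20 : (0 < e / 2)%R by rewrite divr_gt0.
have [h [ch h01 he]] := Ah _ e20; have [h' [ch' h01' he']] := Ah' _ e20.
have cm : continuous (fun x => Num.max (h x) (h' x)).
  by move=> x; apply: (@continuous_max _ _ h h'); [exact: ch|exact: ch'].
exists (fun x => Num.max (h x) (h' x)); split => //.
  move=> x; have := h01 x; have := h01' x; rewrite le_max ge_max.
  by move=> /andP[-> ->] /andP[-> ->].
rewrite [e%:E](_ : _ = (e / 2)%:E + (e / 2)%:E); last by rewrite -EFinD -splitr.
apply: (le_trans _ (leeD he he')); rewrite -ge0_integralD//; last 2 first.
- exact: measurable_dist.
- exact: measurable_dist.
apply: ge0_le_integral => //.
- by apply: measurable_dist => //; exact: measurableU.
- by apply: emeasurable_funD; exact: measurable_dist.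
move=> x _; rewrite -EFinD lee_fin !indicE in_setU.
have d1 (a : R) : (0 <= a <= 1)%R -> (`|a - 1| = 1 - a)%R.
  by move=> /andP[_ a1]; rewrite distrC ger0_norm// subr_ge0.
have d0 (a : R) : (0 <= a <= 1)%R -> (`|a - 0| = a)%R.
  by move=> /andP[a0 _]; rewrite subr0 ger0_norm.
have [hh|hh] := leP (h x) (h' x); have := h01 x; have := h01' x.
  case: (x \in A); case: (x \in A') => /= h'x hx;
  rewrite ?mulr1n ?mulr0n ?(d1 _ hx) ?(d1 _ h'x) ?(d0 _ hx) ?(d0 _ h'x); lra.
case: (x \in A); case: (x \in A') => /= h'x hx;
rewrite ?mulr1n ?mulr0n ?(d1 _ hx) ?(d1 _ h'x) ?(d0 _ hx) ?(d0 _ h'x); lra.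
Qed.

(** As [m] is finite, some finite union [G n] misses only a set of measure at most [e / 2]; an
    approximant of [G n] within [e / 2] then serves for the whole union. *)
Let L1_approx_bigcup (F : (set B)^nat) : (forall n, L1_approx (F n)) ->
  L1_approx (\bigcup_n F n).
Proof.
move=> FL; have mF n : measurable (F n) by case: (FL n).
have mUF : measurable (\bigcup_n F n) by exact: bigcup_measurable.
split => // e e0; pose G n := \big[setU/set0]_(i < n) F i.
have GL n : L1_approx (G n).
  rewrite /G; elim: n => [|n ih]; last by rewrite big_ord_recr/=; exact: L1_approxU.
  by rewrite big_ord0; apply: L1_approx_open; exact: open0.
have mG n : measurable (G n) by case: (GL n).
have e20 : (0 < e / 2)%R by rewrite divr_gt0.
have GF n : G n `<=` \bigcup_n F n by exact: bigsetU_bigcup.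
have : m (\bigcup_n F n `\` G n) @[n --> \oo] --> m (\bigcap_n (\bigcup_n F n `\` G n)).
  apply: (@nonincreasing_cvg_mu _ _ _ m (fun n => \bigcup_n F n `\` G n)).
  - by rewrite ltey_eq fin_num_measure//; exact: measurableD.
  - by move=> n; exact: measurableD.
  - by apply: bigcapT_measurable => n; exact: measurableD.
  - move=> a b ab; apply/subsetPset; apply: setDS.
    exact: subset_bigsetU.
rewrite [X in m X](_ : _ = set0); last first.
  apply/seteqP; split => // x xG; have [[i _ Fix] _] := xG 0%N I.
  have [_] := xG i.+1 I; apply; rewrite /G -bigcup_mkord; exists i => //=.
rewrite measure0 => /fine_cvgP[fin /cvgrPdist_lt /(_ _ e20) small].
near \oo => n; have [h [ch h01 he]] := (GL n).2 _ e20; exists h; split => //.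
have mD : measurable (\bigcup_n F n `\` G n) by exact: measurableD.
have sm : m (\bigcup_n F n `\` G n) <= (e / 2)%:E.
  rewrite -(@fineK _ (m _)) ?fin_num_measure// lee_fin ltW//.
  rewrite -[ltLHS]ger0_norm ?fine_ge0// -normrN -sub0r; by near: n.
rewrite [e%:E](_ : _ = (e / 2)%:E + (e / 2)%:E); last by rewrite -EFinD -splitr.
apply: (le_trans _ (leeD he sm)).
rewrite -[X in _ + m X]setIT -integral_indic// -ge0_integralD//; last 2 first.
- exact: measurable_dist.
- exact/measurable_EFinP.
apply: ge0_le_integral => //.
- exact: measurable_dist.
- by apply: emeasurable_funD; [exact: measurable_dist|exact/measurable_EFinP].
move=> x _; rewrite -EFinD lee_fin.
rewrite (_ : (h x - _ = h x - \1_(G n) x - \1_(\bigcup_n F n `\` G n) x)%R); last first.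
  rewrite -addrA -opprD; congr (_ - _)%R; rewrite !indicE in_setD.
  have [xG|_] := boolP (x \in G n); last by rewrite andbT add0r.
  have -> : x \in \bigcup_k F k by rewrite inE; apply: (GF n); rewrite inE in xG.
  by rewrite andbF addr0.
by rewrite (le_trans (ler_normB _ _))// lerD2l ger0_norm.
Unshelve. all: by end_near. Qed.

Lemma continuous_dense_L1 (A : set B) (e : R) : measurable A -> (0 < e)%R ->
  exists h : E -> R, [/\ continuous h, forall x, (0 <= h x <= 1)%R &
    \int[m]_x (`|h x - \1_A x|%:E) <= e%:E].
Proof.
move=> mA e0; suff [_] : L1_approx A by exact.
have : <<s @open E >> `<=` L1_approx; last by apply.
apply: smallest_sub; last exact: L1_approx_open.
split.
- by apply: L1_approx_open; exact: open0.
- by move=> C LC; rewrite setTD; exact: L1_approxC.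
- exact: L1_approx_bigcup.
Qed.

End density.
End polish_topology.

(** * The largest measure below a content *)

Section content_core.
Context d (T : measurableType d) (R : realType) (lam : {content set T -> \bar R}).
Local Open Scope ereal_scope.

(** Cutting every set of a cover of [X] along [A] yields covers of the two parts of [X], and finite
    additivity of [lam] preserves the total. *)
Lemma content_caratheodory A : measurable A -> (lam^*)%mu.-caratheodory A.
Proof.
move=> mA; apply: le_caratheodory_measurable => X.
apply: le_ereal_inf_tmp => _ [F [mF XF] <-].
rewrite (eq_eseriesr (g := fun k => lam (F k `&` A) + lam (F k `&` ~` A))); last first.
  move=> k _; rewrite -measureU//; last 3 first.
  - exact: measurableI.
  - by apply: measurableI => //; exact: measurableC.
  - by rewrite setIACA setICr setI0.
  by rewrite -setIUr setUCr setIT.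
rewrite nneseriesD//; apply: leeD; apply: ereal_inf_lbound.
- exists (fun k => F k `&` A) => //; split; first by move=> k; exact: measurableI.
  by rewrite -setI_bigcupl; exact: setSI.
- exists (fun k => F k `&` ~` A) => //; split.
    by move=> k; apply: measurableI => //; exact: measurableC.
  by rewrite -setI_bigcupl; exact: setSI.
Qed.

(** The outer measure built from countable measurable covers is countably additive on measurable
    sets even though [lam] is only finitely additive. For finite [lam] this is the countably
    additive part of its Yosida-Hewitt decomposition. *)
Definition content_core (A : set T) : \bar R := (lam^*)%mu A.

Let content_core_sigma_additive : semi_sigma_additive content_core.
Proof.
move=> F mF tF mUF; apply: (@caratheodory_measure_sigma_additive _ _ (lam^*)%mu) => //.
- by move=> i; exact: content_caratheodory.
- exact: content_caratheodory.
Qed.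

HB.instance Definition _ := isMeasure.Build _ _ _ content_core
  (mu_ext0 (measure0 lam) (measure_ge0 lam)) (mu_ext_ge0 (measure_ge0 lam))
  content_core_sigma_additive.

Lemma content_core_le A : measurable A -> content_core A <= lam A.
Proof.
move=> mA; apply: ereal_inf_lbound.
exists (fun n => if n is 0%N then A else set0).
  by split=> [[]// _|t Xt]; exists 0%N.
apply/cvg_lim => //; rewrite -cvg_shiftS.
rewrite (_ : [sequence _]_n = cst (lam A)); first exact: cvg_cst.
by rewrite funeqE => n /=; rewrite big_nat_recl//= big1 ?adde0.
Qed.

Lemma content_core_max (nu : {measure set T -> \bar R}) A :
  (forall C, measurable C -> nu C <= lam C) -> measurable A ->
  nu A <= content_core A.
Proof.
move=> nulam mA; apply: le_ereal_inf_tmp => _ [F [mF AF] <-].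
apply: (le_trans (measure_sigma_subadditive nu mF mA AF)).
by apply: lee_nneseries => // k _; exact: nulam.
Qed.

End content_core.

(** One ultrafilter gives limits to all bounded sequences at once, with no extraction of
    subsequences. Compactness of [[0, c]] provides a cluster point, and an ultrafilter converges to
    its cluster points. *)
Lemma ultra_bounded_cvg {R : realType} {I : Type} (U : set_system I)
    (a : I -> R) (c : R) : UltraFilter U -> (forall i, 0 <= a i <= c) ->
  exists l : R, a @ U --> l.
Proof.
move=> UU ac; have aF : U (a @^-1` [set` `[0, c]]).
  by apply: filterE => i; rewrite /= in_itv/=.
have [l [_ cl]] := @segment_compact R 0 c (a @ U) _ aF.
exists l => V Vl; have [//|UV] := in_ultra_setVsetC (a @^-1` V) UU.
have UV' : (a @ U) (~` V) by exact: UV.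
by have [x []] := cl _ _ UV' Vl.
Qed.

(** * Almost invariance *)

Section almost_invariance.
Context {R : realType} {E : ptopologicalType}.
Local Notation B := (borelE E).
Variable P : R -> B -> probability B R.
Hypothesis pE : polish R E.
Hypothesis hP : transition_function P.
Variables (mu : {finite_measure set B -> \bar R}).
Local Open Scope ereal_scope.
(** Together with [mu_half], this conclusion of [weak_limit_partition] is all that almost invariance
    draws from the construction of [mu]. *)
Hypothesis mu_partition : forall (f0 f1 f2 : E -> R) (t0 t1 t2 : R),
  continuous f0 -> continuous f1 -> continuous f2 ->
  (forall x, (0 <= f0 x)%R) -> (forall x, (0 <= f1 x)%R) -> (forall x, (0 <= f2 x)%R) ->
  (forall x, (f0 x + f1 x + f2 x = 1)%R) ->
  (0 <= t0)%R -> (0 <= t1)%R -> (0 <= t2)%R ->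
  \int[mu]_x Pt P t0 (EFin \o f0) x + \int[mu]_x Pt P t1 (EFin \o f1) x +
  \int[mu]_x Pt P t2 (EFin \o f2) x <= 1.
Variables (alpha : R) (a0 : (0 < alpha)%R).
Local Notation m := (exponential_average hP a0 mu).
Notation leb := (@lebesgue_measure R).

Let mE (f : E -> R) : continuous f -> measurable_fun setT (EFin \o f : B -> \bar R).
Proof. by move=> cf; apply/measurable_EFinP; exact: continuous_borelE_measurable. Qed.

(** The inequality for [mu] at the times [s + t], [s + r] and [s] is integrated against the
    exponential density in [s], which has mass 1. *)
Lemma exponential_average_partition (f0 f1 f2 : E -> R) (t r : R) :
  continuous f0 -> continuous f1 -> continuous f2 ->
  (forall x, (0 <= f0 x)%R) -> (forall x, (0 <= f1 x)%R) -> (forall x, (0 <= f2 x)%R) ->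
  (forall x, (f0 x + f1 x + f2 x = 1)%R) -> (0 <= t)%R -> (0 <= r)%R ->
  \int[m]_x Pt P t (EFin \o f0) x + \int[m]_x Pt P r (EFin \o f1) x +
  \int[m]_x (EFin \o f2) x <= 1.
Proof.
move=> c0 c1 c2 p0 p1 p2 fE t0 r0.
have q0 (x : B) : 0 <= (EFin \o f0) x by rewrite lee_fin.
have q1 (x : B) : 0 <= (EFin \o f1) x by rewrite lee_fin.
have q2 (x : B) : 0 <= (EFin \o f2) x by rewrite lee_fin.
have [[m0 m1] m2] := (mE c0, mE c1, mE c2).
have Q0 := Pt_ge0 P t q0; have Q1 := Pt_ge0 P r q1.
have M0 := measurable_Pt hP t0 q0 m0; have M1 := measurable_Pt hP r0 q1 m1.
pose w := exponential_pdf alpha.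
have w0 s : 0 <= (w s)%:E by rewrite lee_fin exponential_pdf_ge0// ltW.
have mw : measurable_fun setT (EFin \o w).
  by apply/measurable_EFinP; exact: measurable_exponential_pdf.
rewrite (integral_time_average _ _ _ _ Q0 M0) (integral_time_average _ _ _ _ Q1 M1).
rewrite (integral_time_average _ _ _ _ q2 m2).
have mG f (f0' : forall x, 0 <= f x) (mf : measurable_fun setT f) :
    measurable_fun setT (fun s : R => (w s)%:E * \int[mu]_x Pt P `|s|%R f x).
  by apply: emeasurable_funM => //; exact: (measurable_integral_Pt hP mu f0' mf).
have G0 f (f0' : forall x, 0 <= f x) s : 0 <= (w s)%:E * \int[mu]_x Pt P `|s|%R f x.
  by apply: mule_ge0; [exact: w0|apply: integral_ge0 => x _; exact: Pt_ge0].
rewrite -(ge0_integralD leb measurableT (fun s _ => G0 _ Q0 s) (mG _ Q0 M0)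
  (fun s _ => G0 _ Q1 s) (mG _ Q1 M1)).
rewrite -(ge0_integralD leb measurableT (fun s _ => adde_ge0 (G0 _ Q0 s) (G0 _ Q1 s))
  (emeasurable_funD (mG _ Q0 M0) (mG _ Q1 M1)) (fun s _ => G0 _ q2 s) (mG _ q2 m2)).
rewrite -(integral_exponential_pdf a0).
apply: ge0_le_integral => //.
- by move=> s _; rewrite !adde_ge0//; exact: G0.
- by apply: emeasurable_funD; [apply: emeasurable_funD|]; exact: mG.
move=> s _.
have PD f u (f0' : forall x, 0 <= f x) (mf : measurable_fun setT f) (u0 : (0 <= u)%R) :
    \int[mu]_x Pt P `|s|%R (Pt P u f) x = \int[mu]_x Pt P (`|s| + u)%R f x.
  by apply: eq_integral => x _; rewrite (PtD hP).
rewrite (PD _ _ q0 m0 t0) (PD _ _ q1 m1 r0).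
have I0 f u (f0' : forall x, 0 <= f x) : 0 <= \int[mu]_x Pt P u f x.
  by apply: integral_ge0 => x _; exact: Pt_ge0.
rewrite -ge0_muleDr; [|exact: I0|exact: I0].
rewrite -ge0_muleDr; [|by apply: adde_ge0; exact: I0|exact: I0].
rewrite -[leRHS]mule1; apply: lee_wpmul2l; first exact: w0.
by apply: mu_partition => //; rewrite addr_ge0.
Qed.

Let m_setT : m setT = mu setT.
Proof. exact: exponential_average_setT. Qed.

Let m_fin : m setT < +oo.
Proof. by rewrite m_setT ltey_eq fin_num_measure. Qed.

(* L is sealed: lra compares atoms up to conversion and would otherwise unfold integrals. *)
Let L_sealed : {L : R -> (B -> \bar R) -> R |
  forall t f, L t f = fine (\int[m]_x Pt P t f x)}.
Proof. by exists (fun t f => fine (\int[m]_x Pt P t f x)). Qed.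

Let L := sval L_sealed.

Let LE t f : L t f = fine (\int[m]_x Pt P t f x).
Proof. exact: (svalP L_sealed). Qed.

Let bounded_le t (f : B -> \bar R) (M : R) : (0 <= t)%R ->
  measurable_fun setT f -> (forall x, 0 <= f x) -> (forall x, f x <= M%:E) ->
  \int[m]_x Pt P t f x = (L t f)%:E.
Proof.
move=> t0 mf f0 fM; rewrite LE fineK// ge0_fin_numE; last first.
  by apply: integral_ge0 => x _; exact: Pt_ge0.
apply: (@le_lt_trans _ _ (M%:E * m setT)).
  rewrite -integral_cst//; apply: ge0_le_integral => //.
  - by move=> x _; exact: Pt_ge0.
  - exact: measurable_Pt.
  - move=> x _; rewrite -(Pt_cst P t M x); apply: le_Pt => //.
have M0 : 0 <= M%:E by rewrite (le_trans (f0 point)).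
by rewrite lte_mul_pinfty.
Qed.

Let L_sub t (f g e : B -> \bar R) (M : R) : (0 <= t)%R ->
  measurable_fun setT f -> measurable_fun setT g -> measurable_fun setT e ->
  (forall x, 0 <= f x) -> (forall x, 0 <= g x) -> (forall x, 0 <= e x) ->
  (forall x, f x <= M%:E) -> (forall x, g x <= M%:E) -> (forall x, e x <= M%:E) ->
  (forall x, f x <= g x + e x) -> (L t f <= L t g + L t e)%R.
Proof.
move=> t0 mf mg me f0 g0 e0 fM gM eM fge.
rewrite -lee_fin EFinD -(bounded_le t0 mf f0 fM) -(bounded_le t0 mg g0 gM).
rewrite -(bounded_le t0 me e0 eM).
rewrite -ge0_integralD//; [|by move=> x _; exact: Pt_ge0|exact: measurable_Pt
  |by move=> x _; exact: Pt_ge0|exact: measurable_Pt].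
apply: ge0_le_integral => //.
- by move=> x _; exact: Pt_ge0.
- exact: measurable_Pt.
- by apply: emeasurable_funD; exact: measurable_Pt.
move=> x _; rewrite -PtDf//; apply: le_Pt => //.
exact: emeasurable_funD.
Qed.

Let L_exp t (f : B -> \bar R) (M : R) : (0 <= t)%R ->
  measurable_fun setT f -> (forall x, 0 <= f x) -> (forall x, f x <= M%:E) ->
  (L t f <= expR (alpha * t) * L 0 f)%R.
Proof.
move=> t0 mf f0 fM.
have := integral_exponential_average_Pt hP a0 mu t0 f0 mf.
rewrite (bounded_le t0 mf f0 fM) (_ : \int[m]_x f x = \int[m]_x Pt P 0 f x).
  by rewrite (bounded_le _ mf f0 fM)// -EFinM lee_fin.
by apply: eq_integral => x _; rewrite Pt0.
Qed.

(** The mass of [m] is written through [L] so that [L_sub] applies to it. *)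
Let c := L 0 (cst 1).

Let m_setTE : m setT = c%:E.
Proof.
rewrite -(bounded_le (M := 1) (lexx _)) => //.
rewrite -[LHS]mul1e -integral_cst//; apply: eq_integral => x _.
by rewrite (Pt0 hP).
Qed.

Let indic (A : set B) : B -> \bar R := fun x => (\1_A x)%:E.

Let mindic A : measurable A -> measurable_fun setT (indic A).
Proof. by move=> mA; exact/measurable_EFinP. Qed.

Let indic0 A x : 0 <= indic A x.
Proof. by rewrite lee_fin. Qed.

Let indic1 A x : indic A x <= 1.
Proof. by rewrite lee_fin indicE; case: (_ \in _). Qed.

(** The partition inequality is rid of [f1] and [f2] by [h1 <= f1 + h0] at time [r], which costs
    [L r h0], and by [1 <= f2 + h0 + h1] at time 0, which costs the last two terms. *)
Let L_continuous (h0 h1 : E -> R) (t r : R) : continuous h0 -> continuous h1 ->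
  (forall x, (0 <= h0 x <= 1)%R) -> (forall x, (0 <= h1 x <= 1)%R) ->
  (0 <= t)%R -> (0 <= r)%R ->
  (L t (EFin \o h0) + L r (EFin \o h1) + c <=
   1 + L r (EFin \o h0) + L 0 (EFin \o h0) + L 0 (EFin \o h1))%R.
Proof.
move=> c0 c1 b0 b1 t0 r0.
have ineq1 (a b : R) : (0 <= a <= 1 -> 0 <= b <= 1 -> b <= (1 - a) * b + a)%R by move=> *; nra.
have ineq2 (a b : R) : (0 <= a <= 1 -> 0 <= b <= 1 -> 1 <= (1 - a) * (1 - b) + (a + b))%R.
  by move=> *; nra.
have ineq3 (a b : R) : (0 <= a <= 1 -> 0 <= b <= 1 -> a + b <= 2)%R by move=> *; lra.
pose f1 x : R := ((1 - h0 x) * h1 x)%R.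
pose f2 x : R := ((1 - h0 x) * (1 - h1 x))%R.
have cB (f : E -> R) : continuous f -> continuous (fun x => 1 - f x)%R.
  by move=> cf x; apply: cvgB; [exact: cvg_cst|exact: cf].
have cf1 : continuous f1 by move=> x; apply: cvgM; [exact: cB|exact: c1].
have cf2 : continuous f2 by move=> x; apply: cvgM; exact: cB.
have f1_01 x : (0 <= f1 x <= 1)%R.
  by have /andP[? ?] := b0 x; have /andP[? ?] := b1 x; rewrite /f1; nra.
have f2_01 x : (0 <= f2 x <= 1)%R.
  by have /andP[? ?] := b0 x; have /andP[? ?] := b1 x; rewrite /f2; nra.
have ge0 (f : E -> R) (x : B) : (forall x, (0 <= f x <= 1)%R) -> 0 <= (EFin \o f) x.
  by move=> f01; rewrite lee_fin; case/andP: (f01 x).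
have le1 (f : E -> R) (x : B) : (forall x, (0 <= f x <= 1)%R) -> (EFin \o f) x <= 1.
  by move=> f01; rewrite lee_fin; case/andP: (f01 x).
have le2 (f : E -> R) (x : B) : (forall x, (0 <= f x <= 1)%R) -> (EFin \o f) x <= 2%:E.
  by move=> f01; rewrite (le_trans (le1 _ x f01))// lee_fin ler1n.
have := @exponential_average_partition h0 f1 f2 t r c0 cf1 cf2.
move=> /(_ (fun x => proj1 (andP (b0 x))) (fun x => proj1 (andP (f1_01 x)))).
move=> /(_ (fun x => proj1 (andP (f2_01 x)))).
have sum1 x : (h0 x + f1 x + f2 x = 1)%R by rewrite /f1 /f2; ring.
move=> /(_ sum1 t0 r0).
rewrite (bounded_le t0 (mE c0) (fun x => ge0 _ x b0) (fun x => le1 _ x b0)).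
rewrite (bounded_le r0 (mE cf1) (fun x => ge0 _ x f1_01) (fun x => le1 _ x f1_01)).
rewrite (_ : \int[m]_x (EFin \o f2) x = \int[m]_x Pt P 0 (EFin \o f2) x); last first.
  by apply: eq_integral => x _; rewrite (Pt0 hP)//; exact: mE.
rewrite (bounded_le (lexx _) (mE cf2) (fun x => ge0 _ x f2_01) (fun x => le1 _ x f2_01)).
rewrite -!EFinD lee_fin => partition.
have h1_le : (L r (EFin \o h1) <= L r (EFin \o f1) + L r (EFin \o h0))%R.
  apply: (L_sub (M := 1) r0 (mE c1) (mE cf1) (mE c0)) => x; rewrite ?ge0 ?le1//.
  by rewrite -EFinD lee_fin; exact: ineq1.
have c01 : continuous (fun x => h0 x + h1 x)%R.
  by move=> x; apply: cvgD; [exact: c0|exact: c1].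
have one_le : (c <= L 0 (EFin \o f2) + L 0 (EFin \o (fun x => h0 x + h1 x)%R))%R.
  apply: (L_sub (M := 2) (lexx _) (measurable_cst _) (mE cf2) (mE c01)) => x//=.
  - exact: ge0.
  - by rewrite lee_fin addr_ge0//; [case/andP: (b0 x)|case/andP: (b1 x)].
  - by rewrite lee_fin ler1n.
  - exact: (le2 _ x f2_01).
  - by rewrite lee_fin; exact: ineq3.
  - by rewrite -EFinD lee_fin; exact: ineq2.
have sum_le : (L 0 (EFin \o (fun x => h0 x + h1 x)%R) <= L 0 (EFin \o h0) + L 0 (EFin \o h1))%R.
  apply: (L_sub (M := 2) (lexx _) (mE c01) (mE c0) (mE c1)) => x//=; rewrite ?ge0 ?le2//.
  - by rewrite lee_fin addr_ge0//; [case/andP: (b0 x)|case/andP: (b1 x)].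
  - by rewrite lee_fin; exact: ineq3.
by lra.
Qed.

(** Since [m P_u] is at most [e^(alpha u) m], an approximation in [L^1(m)] remains one after
    applying [P_u], so indicators can replace [h0] and [h1]. *)
Let L_indic A0 A1 (t r : R) : measurable A0 -> measurable A1 ->
  (0 <= t)%R -> (0 <= r)%R ->
  (L t (indic A0) + L r (indic A1) + c <=
   1 + L r (indic A0) + L 0 (indic A0) + L 0 (indic A1))%R.
Proof.
move=> mA0 mA1 t0 r0; apply/ler_addgt0Pr => e e0.
(* [C] counts the replacement errors: one at time [t], two at time [r] and two at time 0, each at
   most [e^(alpha u) (e / C)] at time [u]. *)
pose C : R := (expR (alpha * t) + 2 * expR (alpha * r) + 2)%R.
have C0 : (0 < C)%R by rewrite /C !addr_gt0// ?mulr_gt0// expR_gt0.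
have eC : (0 < e / C)%R by rewrite divr_gt0.
pose m' := finite_measure_of m_fin.
have [h0 [ch0 h0_01 h0e]] := continuous_dense_L1 pE m' mA0 eC.
have [h1 [ch1 h1_01 h1e]] := continuous_dense_L1 pE m' mA1 eC.
have := L_continuous ch0 ch1 h0_01 h1_01 t0 r0.
pose er (h : E -> R) (A : set B) (x : B) : \bar R := (`|h x - \1_A x|%:E).
have mer h A : continuous h -> measurable A -> measurable_fun setT (er h A).
  move=> ch mA; apply/measurable_EFinP; apply: measurableT_comp => //.
  by apply: measurable_funB => //; exact: continuous_borelE_measurable.
have er0 h A x : 0 <= er h A x by rewrite lee_fin.
have er1 h A x : (forall x, (0 <= h x <= 1)%R) -> er h A x <= 1.
  move=> h01; rewrite lee_fin indicE ler_norml; have := h01 x.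
  by case: (_ \in _) => /=; lra.
have ge0 (f : E -> R) (x : B) : (forall x, (0 <= f x <= 1)%R) -> 0 <= (EFin \o f) x.
  by move=> f01; rewrite lee_fin; case/andP: (f01 x).
have le1 (f : E -> R) (x : B) : (forall x, (0 <= f x <= 1)%R) -> (EFin \o f) x <= 1.
  by move=> f01; rewrite lee_fin; case/andP: (f01 x).
have er_small (h : E -> R) (A : set B) (u : R) :
    continuous h -> (forall x, (0 <= h x <= 1)%R) -> measurable A ->
    (0 <= u)%R -> \int[m']_x (`|h x - \1_A x|%:E) <= (e / C)%:E ->
    (L u (er h A) <= expR (alpha * u) * (e / C))%R.
  move=> ch h01 mA u0 he.
  apply: (le_trans (L_exp u0 (mer _ _ ch mA) (er0 h A) (fun x => er1 h A x h01))).
  rewrite ler_pM2l ?expR_gt0// -lee_fin.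
  rewrite -(bounded_le (lexx _) (mer _ _ ch mA) (er0 h A) (fun x => er1 h A x h01)).
  rewrite (_ : \int[m]_x _ = \int[m]_x er h A x); first exact: he.
  by apply: eq_integral => x _; rewrite (Pt0 hP)//; exact: mer.
have up (h : E -> R) (A : set B) (u : R) :
    continuous h -> (forall x, (0 <= h x <= 1)%R) -> measurable A ->
    (0 <= u)%R -> (L u (indic A) <= L u (EFin \o h) + L u (er h A))%R.
  move=> ch h01 mA u0.
  apply: (L_sub (M := 1) u0 (mindic mA) (mE ch) (mer _ _ ch mA)) => x//;
    rewrite ?ge0 ?le1 ?er1//.
  by rewrite -EFinD lee_fin -lerBlDl distrC ler_norm.
have down (h : E -> R) (A : set B) (u : R) :
    continuous h -> (forall x, (0 <= h x <= 1)%R) -> measurable A ->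
    (0 <= u)%R -> (L u (EFin \o h) <= L u (indic A) + L u (er h A))%R.
  move=> ch h01 mA u0.
  apply: (L_sub (M := 1) u0 (mE ch) (mindic mA) (mer _ _ ch mA)) => x//;
    rewrite ?ge0 ?le1 ?er1//.
  by rewrite -EFinD lee_fin -lerBlDl ler_norm.
have := up _ _ _ ch0 h0_01 mA0 t0; have := up _ _ _ ch1 h1_01 mA1 r0.
have := down _ _ _ ch0 h0_01 mA0 r0; have := down _ _ _ ch0 h0_01 mA0 (lexx _).
have := down _ _ _ ch1 h1_01 mA1 (lexx _).
have := er_small _ _ _ ch0 h0_01 mA0 t0 h0e; have := er_small _ _ _ ch1 h1_01 mA1 r0 h1e.
have := er_small _ _ _ ch0 h0_01 mA0 r0 h0e.
have := er_small _ _ _ ch0 h0_01 mA0 (lexx _) h0e.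
have := er_small _ _ _ ch1 h1_01 mA1 (lexx _) h1e.
rewrite mulr0 expR0 !mul1r.
have eE : e = (expR (alpha * t) * (e / C) + 2 * (expR (alpha * r) * (e / C)) + 2 * (e / C))%R.
  by rewrite mulrA -!mulrDl -/C mulrCA divff ?mulr1// gt_eqF.
move: eE; move: (e / C)%R => d; clearbody C => eE.
by lra.
Qed.

Hypothesis mu_half : (2^-1)%:E <= mu setT.

Lemma exponential_average_almost_invariant : almost_invariant P m.
Proof.
have c_half : (2^-1 <= c)%R by rewrite -lee_fin -m_setTE m_setT.
have c_gt0 : (0 < c)%R by rewrite (lt_le_trans _ c_half)// invr_gt0.
have PtE t A : measurable A -> (0 <= t)%R -> \int[m]_x P t x A = (L t (indic A))%:E.
  move=> mA t0; rewrite -(bounded_le t0 (mindic mA) (indic0 A) (indic1 A)).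
  by apply: eq_integral => x _; rewrite Pt_indic.
have mA_E A : measurable A -> m A = (L 0 (indic A))%:E.
  move=> mA; rewrite -(bounded_le (lexx _) (mindic mA) (indic0 A) (indic1 A)).
  transitivity (\int[m]_x indic A x); first by rewrite integral_indic// setIT.
  by apply: eq_integral => x _; rewrite (Pt0 hP)//; exact: mindic.
have L_ge0 t A : (0 <= L t (indic A))%R.
  by rewrite LE; apply: fine_ge0; apply: integral_ge0 => x _; exact: Pt_ge0.
have L_le_c t A : measurable A -> (0 <= t)%R -> (L t (indic A) <= c)%R.
  move=> mA t0; rewrite -lee_fin -m_setTE -PtE//.
  rewrite -[leRHS]mul1e -integral_cst//; apply: ge0_le_integral => //.
  - exact: measurable_transition.
  - by move=> x _; exact: probability_le1.
split; first exact: m_fin.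
split.
  move=> f mf f0 mf0 t t0; apply/eqP; rewrite eq_le; apply/andP; split.
    have := integral_exponential_average_Pt hP a0 mu (ltW t0) f0 mf.
    by rewrite mf0 mule0.
  by apply: integral_ge0 => x _; exact: Pt_ge0.
have [eta eta0 small] : exists2 eta : R, (0 < eta)%R & forall t A, (0 < t)%R ->
    measurable A -> (L 0 (indic A) < eta)%R -> (L t (indic A) <= 9 / 10 * c)%R.
  have [[r [A1 [r0 mA1 A1_small A1_big]]]|no] := pselect (exists r A1, [/\ (0 < r)%R,
      measurable A1, (L 0 (indic A1) < c / 10)%R & (9 / 10 * c < L r (indic A1))%R]).
    (* Below this threshold both [m(A)] and [m(P_r A)] are less than [c / 10]. If [m(P_t A)]
       exceeded [9c/10], then [L_indic] would give [14c/5 < 1 + 3c/10], that is [c < 2/5], against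
       [c >= 1/2]. *)
    exists (c / 10 / expR (alpha * r))%R; first by rewrite !divr_gt0// expR_gt0.
    move=> t A t0 mA A_small; rewrite leNgt; apply/negP => A_big.
    have := L_indic mA mA1 (ltW t0) (ltW r0).
    have := L_exp (ltW r0) (mindic mA) (indic0 A) (indic1 A).
    move: A_small; rewrite ltr_pdivlMr ?expR_gt0// [X in (X < _)%R]mulrC => A_small.
    have : (L 0 (indic A) <= expR (alpha * r) * L 0 (indic A))%R.
      by rewrite ler_peMl// -expR0 ler_expR mulr_ge0// ltW.
    by lra.
  (* If no such pair exists, the bound holds by this very absence for all sets of measure below
     [c / 10]. *)
  exists (c / 10)%R; first by rewrite divr_gt0.
  move=> t A t0 mA A_small; rewrite leNgt; apply/negP => A_big.
  by apply: no; exists t, A.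
exists (9 / 10)%R; split; first by lra.
(* Below the threshold [delta] alone suffices; above it the total mass [c] bounds [m(P_t A)]. *)
exists (fun A => if m A < eta%:E then 0%R else c); split.
  by move=> A mA; case: ifPn => // _; exact: ltW.
split.
  by move=> eps eps0; exists eta => // A mA ->.
move=> t t0 A mA; rewrite m_setTE PtE ?(ltW t0)// -EFinM -EFinD lee_fin.
case: ifPn => [|_].
  by rewrite mA_E// lte_fin addr0 => /small; exact.
by have := L_le_c t A mA (ltW t0); lra.
Qed.

End almost_invariance.

(** * Existence of an invariant measure *)

Section invariant.
Context {R : realType} {E : ptopologicalType}.
Local Notation B := (borelE E).
Variable P : R -> B -> probability B R.
Hypothesis hP : transition_function P.
Variables (m : {finite_measure set B -> \bar R}).
Local Open Scope ereal_scope.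
Notation leb := (@lebesgue_measure R).

Variable U : set_system nat.
Hypotheses (UU : UltraFilter U) (Uoo : (\oo : set_system nat) `<=` U).

Let M (n : nat) : {measure set B -> \bar R} := cesaro_average hP (ltr0Sn R n) m.

Let c : R := fine (m setT).

Let mTE : m setT = c%:E.
Proof. by rewrite fineK// fin_num_measure. Qed.

Let c_ge0 : (0 <= c)%R.
Proof. exact: fine_ge0. Qed.

Let MT n : M n setT = c%:E.
Proof. by rewrite /M cesaro_average_setT. Qed.

Let M_le n A : measurable A -> M n A <= c%:E.
Proof. by move=> mA; rewrite -(MT n) le_measure ?inE. Qed.

Let M_fin n A : measurable A -> M n A \is a fin_num.
Proof. by move=> mA; rewrite ge0_fin_numE// (le_lt_trans (M_le n mA))// ltry. Qed.

Let a (A : set B) (n : nat) : R := fine (M n A).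

Let aE A n : measurable A -> M n A = (a A n)%:E.
Proof. by move=> mA; rewrite fineK// M_fin. Qed.

Let a_ge0 A n : (0 <= a A n)%R.
Proof. exact: fine_ge0. Qed.

Let cvg_lim_a A : measurable A -> a A @ U --> lim (a A @ U).
Proof.
move=> mA; have [|l /cvgP//] := @ultra_bounded_cvg R _ U (a A) c UU.
by move=> n; rewrite a_ge0 -lee_fin -aE// M_le.
Qed.

Let M_indic n A : measurable A -> M n A = (n.+1%:R^-1)%:E *
  \int[leb]_(s in `[0%R, n.+1%:R]) \int[m]_x Pt P s (fun y => (\1_A y)%:E) x.
Proof.
move=> mA; transitivity (\int[M n]_x (\1_A x)%:E); first by rewrite integral_indic// setIT.
by rewrite integral_cesaro_average//; exact/measurable_EFinP.
Qed.

(* The maximum only matters on nonmeasurable sets, where the limit is a junk value. *)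
Definition cesaro_limit (A : set B) : \bar R := (Num.max 0 (lim (a A @ U)))%:E.

Let cvg_a A : measurable A -> a A @ U --> fine (cesaro_limit A).
Proof.
move=> mA; rewrite /= max_r; first exact: cvg_lim_a.
by apply: (cvgr_to_ge (cvg_lim_a mA)); exact: nearW.
Qed.

Let cesaro_limitP A (l : R) : measurable A -> a A @ U --> l -> cesaro_limit A = l%:E.
Proof.
move=> mA al; congr EFin; apply: (cvg_unique _ (cvg_a mA) al).
exact: Rhausdorff.
Qed.

Let cesaro_limit_ge0 A : 0 <= cesaro_limit A.
Proof. by rewrite lee_fin le_max lexx. Qed.

Let cesaro_limit0 : cesaro_limit set0 = 0.
Proof.
apply: cesaro_limitP => //; rewrite (_ : a set0 = cst 0%R); first exact: cvg_cst.
by apply/funext => n; rewrite /a measure0.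
Qed.

Let cesaro_limit_semi_additive : measure_function.semi_additive cesaro_limit.
Proof.
apply/(additive2P cesaro_limit0) => A A' mA mA' AA'.
rewrite (@cesaro_limitP _ (fine (cesaro_limit A) + fine (cesaro_limit A'))%R) //.
  exact: measurableU.
rewrite (_ : a (A `|` A') = (fun n => a A n + a A' n)%R).
  by apply: cvgD; exact: cvg_a.
apply/funext => n; rewrite /a measureU// fineD//; exact: M_fin.
Qed.

HB.instance Definition _ := isContent.Build _ _ _ cesaro_limit
  cesaro_limit_ge0 cesaro_limit_semi_additive.

Definition cesaro_core : {measure set B -> \bar R} := content_core cesaro_limit.
Local Notation eta := cesaro_core.

Let cesaro_limitT : cesaro_limit setT = c%:E.
Proof.
apply: cesaro_limitP => //; rewrite (_ : a setT = cst c); first exact: cvg_cst.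
by apply/funext => n; rewrite /a MT.
Qed.

Let eta_fin : eta setT < +oo.
Proof.
apply: (@le_lt_trans _ _ c%:E); last exact: ltry.
by rewrite -cesaro_limitT; exact: (content_core_le _ measurableT).
Qed.

Import HBNNSimple.

(** For simple [g] only finite sums occur, so [cesaro_limit] can be handled without countable
    additivity: [eta] is below it on level sets, and [M n (g) <= M n (P_t A) <= M n (A) + t c / (n +
    1)] passes to the limit along [U]. *)
Let integral_eta_nnsfun t A (g : {nnsfun B >-> R}) : (0 <= t)%R -> measurable A ->
  (forall x, (g x)%:E <= P t x A) -> \int[eta]_x (g x)%:E <= cesaro_limit A.
Proof.
move=> t0 mA gA; rewrite integralT_nnsfun sintegralE.
have mg r : measurable (g @^-1` [set r]) by [].
pose r : seq R := finmap.enum_fset (fset_set (range g)).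
apply: (@le_trans _ _ (\sum_(x <- r) (x * fine (cesaro_limit (g @^-1` [set x]))))%R%:E).
  rewrite fsbig_finite//= -sumEFin big_seq [in leRHS]big_seq; apply: lee_sum => x.
  rewrite in_fset_set// inE => -[y _ <-]; rewrite EFinM; apply: lee_wpmul2l.
    by rewrite lee_fin.
  exact: (content_core_le cesaro_limit (mg _)).
have cvg_sum : (\sum_(x <- r) (x * a (g @^-1` [set x]) n))%R @[n --> U] -->
    (\sum_(x <- r) (x * fine (cesaro_limit (g @^-1` [set x]))))%R.
  elim: r => [|x s ih].
    rewrite big_nil (_ : (fun n => _) = cst 0%R); first exact: cvg_cst.
    by apply/funext => n; rewrite big_nil.
  rewrite big_cons (_ : (fun n => _) = (fun n => x * a (g @^-1` [set x]) n +
      \sum_(y <- s) (y * a (g @^-1` [set y]) n))%R); last first.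
    by apply/funext => n; rewrite big_cons.
  by apply: cvgD => //; apply: cvgM; [exact: cvg_cst|exact: cvg_a].
have cvg_rhs : (a A n + n.+1%:R^-1 * t * c)%R @[n --> U] -->
    (fine (cesaro_limit A) + 0 * t * c)%R.
  apply: cvgD; first exact: cvg_a.
  apply: cvgM; last exact: cvg_cst.
  apply: cvgM; last exact: cvg_cst.
  by apply: (cvg_trans (cvg_app _ Uoo)); exact: cvg_harmonic.
rewrite -[cesaro_limit A]/(fine (cesaro_limit A))%:E lee_fin.
apply: (@le_trans _ _ (fine (cesaro_limit A) + 0 * t * c)%R); last by rewrite !mul0r addr0.
apply: (ler_cvg_to cvg_sum cvg_rhs); apply: nearW => n.
rewrite -lee_fin; have -> : (\sum_(x <- r) (x * a (g @^-1` [set x]) n)%R)%:E =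
    \int[M n]_x (g x)%:E.
  rewrite integralT_nnsfun sintegralE fsbig_finite//= -sumEFin.
  by apply: eq_bigr => x _; rewrite EFinM -aE.
rewrite EFinD -aE//.
have PtA x : P t x A = Pt P t (fun y => (\1_A y)%:E) x by rewrite Pt_indic.
have mP := measurable_transition hP t0 mA.
apply: (@le_trans _ _ (\int[M n]_x P t x A)).
  apply: ge0_le_integral => //.
  - by move=> x _; rewrite lee_fin.
  - exact/measurable_EFinP.
rewrite (eq_integral _ _ (fun x _ => PtA x)).
have mI : measurable_fun setT (fun y : B => (\1_A y : R)%:E) by exact/measurable_EFinP.
have := @integral_cesaro_average_Pt _ _ _ hP _ (ltr0Sn R n) m t (fun y => (\1_A y)%:E) t0.
rewrite mTE integral_indic// setIT EFinM; apply => //.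
by move=> x; rewrite lee_fin indicE; case: (_ \in _).
Qed.

(** Monotone convergence is applied on the side of the measure [eta], the bound by [cesaro_limit A]
    being the same for every simple approximant. *)
Let integral_eta_le t A : (0 <= t)%R -> measurable A ->
  \int[eta]_x P t x A <= cesaro_limit A.
Proof.
move=> t0 mA; have mP := measurable_transition hP t0 mA.
pose g := nnsfun_approx measurableT mP.
have PtA0 x : setT x -> 0 <= P t x A by [].
rewrite (_ : \int[eta]_x _ = \int[eta]_x limn (EFin \o g^~ x)).
  have cg : \int[eta]_x (g n x)%:E @[n --> \oo] --> \int[eta]_x limn (EFin \o g^~ x).
    apply: cvg_monotone_convergence => //.
    - by move=> n; exact/measurable_EFinP.
    - by move=> n x _; rewrite lee_fin.
    - by move=> x _ i j ij; rewrite lee_fin; exact/lefP/nd_nnsfun_approx.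
  apply: (cvge_to_le cg); apply: nearW => n; apply: (integral_eta_nnsfun t0 mA) => x.
  by rewrite nnsfun_approxE; exact: le_approx.
by apply: eq_integral => x _; apply/esym/cvg_lim => //; exact: cvg_nnsfun_approx.
Qed.

Let mixture_eta t (t0 : (0 <= t)%R) : {measure set B -> \bar R} :=
  mixture eta (fun A => @measurable_transition _ _ _ hP t A t0).

(** The measure [eta P_t] lies below [cesaro_limit], hence below [eta] by maximality. Both have the
    same finite mass, so a strict inequality on [A] could not be made up on the complement. *)
Let mixture_etaE t (t0 : (0 <= t)%R) A : measurable A -> mixture_eta t0 A = eta A.
Proof.
move=> mA.
have le_eta C : measurable C -> mixture_eta t0 C <= eta C.
  by move=> mC; apply: (content_core_max (lam := cesaro_limit)) => // D mD;
    exact: integral_eta_le.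
have totE : mixture_eta t0 setT = eta setT.
  rewrite -[RHS]mul1e -integral_cst//; apply: eq_integral => x _.
  exact: probability_setT.
apply/eqP; rewrite eq_le le_eta//= leNgt; apply/negP => lt_eta.
have etaA_fin C : measurable C -> eta C \is a fin_num.
  move=> mC; rewrite ge0_fin_numE// (le_lt_trans _ eta_fin)// le_measure ?inE//.
suff : mixture_eta t0 setT < eta setT by rewrite totE ltxx.
rewrite -(setvU A) !measureU//;
  [|exact: measurableC|exact: setICl|exact: measurableC|exact: setICl].
apply: lee_ltD => //; last exact: le_eta (measurableC mA).
rewrite ge0_fin_numE// (le_lt_trans (le_eta _ (measurableC mA)))//.
by rewrite -ge0_fin_numE// etaA_fin//; exact: measurableC.
Qed.

Let integral_eta_Pt t (f : B -> \bar R) : (0 <= t)%R -> (forall x, 0 <= f x) ->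
  measurable_fun setT f -> \int[eta]_x Pt P t f x = \int[eta]_x f x.
Proof.
move=> t0 f0 mf; transitivity (\int[mixture_eta t0]_x f x).
  exact/esym/integral_mixture.
by apply: eq_measure_integral => A mA _; exact: (mixture_etaE t0).
Qed.

Let eta_invariant (t : R) (f : B -> R) : (0 <= t)%R -> measurable_fun setT f ->
  (exists K : R, forall x, (`|f x| <= K)%R) ->
  \int[eta]_x Pt P t (fun y => (f y)%:E) x = \int[eta]_x (f x)%:E.
Proof.
move=> t0 mf [K fK]; set F := fun y => (f y)%:E.
have mF : measurable_fun setT F by exact/measurable_EFinP.
have K0 : (0 <= K)%R by rewrite (le_trans _ (fK point)).
have bound (g : B -> \bar R) : (forall x, 0 <= g x) -> (forall x, g x <= K%:E) ->
    measurable_fun setT g -> eta.-integrable setT (Pt P t g).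
  move=> g0 gK mg; have mPg := measurable_Pt hP t0 g0 mg.
  apply: (@le_integrable _ _ _ _ _ _ _ (cst K%:E)) => //.
    move=> x _; rewrite gee0_abs; last exact: Pt_ge0.
    rewrite /= ger0_norm//.
    by rewrite -(Pt_cst P t K x); apply: le_Pt => //.
  apply/integrableP; split => //.
  rewrite integral_cst//= lte_mul_pinfty//.
have mp : measurable_fun setT F^\+ by exact: measurable_funepos.
have mn : measurable_fun setT F^\- by exact: measurable_funeneg.
have FK x : (f x <= K /\ - f x <= K)%R.
  by have := fK x; rewrite ler_norml lerNl => /andP[].
have pK x : F^\+ x <= K%:E by rewrite funeposE ge_max !lee_fin (FK x).1.
have nK x : F^\- x <= K%:E by rewrite funenegE ge_max !lee_fin (FK x).2.
(* The signed case reduces to the positive and negative parts, whose images under [P_t] are bounded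
   by [K] and so integrable for the finite measure [eta]. *)
rewrite (eq_integral (fun x => Pt P t F^\+ x - Pt P t F^\- x)); last first.
  by move=> x _; rewrite /Pt integralE.
rewrite integralB//; [|exact: bound|exact: bound].
by rewrite !integral_eta_Pt// [RHS]integralE.
Qed.

Hypothesis am : almost_invariant P m.
Hypothesis m_neq0 : m setT <> 0.

(** An [m]-null set is null for every [m P_s], hence for all the Cesaro averages and their limit,
    which bounds [eta]. *)
Let eta_dominated : eta `<< m.
Proof.
apply/null_content_dominatesP => A mA mA0.
have [_ [am0 _]] := am.
have mI : measurable_fun setT (fun y : B => (\1_A y : R)%:E) by exact/measurable_EFinP.
have I0 (y : B) : 0 <= (\1_A y : R)%:E by rewrite lee_fin.
have mI0 : \int[m]_x (\1_A x)%:E = 0 by rewrite integral_indic// setIT.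
have lim0 : cesaro_limit A = 0.
  apply: cesaro_limitP => //; rewrite (_ : a A = cst 0%R); first exact: cvg_cst.
  apply/funext => n; rewrite /a M_indic//.
  rewrite integral0_eq ?mule0// => s; rewrite /= in_itv/= => /andP[s0 _].
  (* Almost invariance covers positive times only; at time 0 the operator is the identity. *)
  move: s0; rewrite le_eqVlt => /orP[/eqP<-|s0]; last exact: am0.
  by rewrite -mI0; apply: eq_integral => x _; rewrite (Pt0 hP).
apply/eqP; rewrite eq_le measure_ge0 andbT -lim0.
exact: (content_core_le _ mA).
Qed.

(** If [eta] vanished, some countable cover would have [cesaro_limit]-masses adding up to less than
    [e]. A large finite union [G n] then has limit mass at most [e], while its complement is
    [m]-small and so has limit mass less than [delta c + e]. *)
Let eta_neq0 : eta setT <> 0.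
Proof.
move=> eta0; have [_ [_ [delta [/andP[d0 d1] [phi [phi0 [phi_small am_le]]]]]]] := am.
have c0 : (0 < c)%R.
  rewrite lt_def c_ge0 andbT; apply/eqP => c0; apply: m_neq0.
  by rewrite mTE c0.
(* Chosen so that [2 e + delta c = c], which makes the final strict inequality read [c < c]. *)
pose e := ((1 - delta) * c / 2)%R.
have e0 : (0 < e)%R by rewrite divr_gt0// mulr_gt0// subr_gt0.
have [u u0 phi_e] := phi_small _ e0.
have lim_le A : measurable A -> cesaro_limit A <= delta%:E * c%:E + (phi A)%:E.
  move=> mA; rewrite -EFinM -EFinD lee_fin.
  apply: (cvgr_to_le (cvg_a mA)); apply: nearW => n.
  have mI : measurable_fun setT (fun y : B => (\1_A y : R)%:E) by exact/measurable_EFinP.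
  have I0 (y : B) : 0 <= (\1_A y : R)%:E by rewrite lee_fin.
  rewrite -lee_fin -aE// M_indic//.
  have mG := measurable_integral_Pt hP m I0 mI.
  have normE b : \int[leb]_(s in [set` Interval (BSide b 0%R) (BRight n.+1%:R)])
      (\int[m]_x Pt P `|s|%R (fun y => (\1_A y)%:E) x) =
      \int[leb]_(s in [set` Interval (BSide b 0%R) (BRight n.+1%:R)])
      (\int[m]_x Pt P s (fun y => (\1_A y)%:E) x).
    apply: eq_integral => s; rewrite inE/= => sn.
    rewrite ger0_norm//; move: sn; rewrite itv_boundlr => /andP[+ _].
    by case: b; rewrite bnd_simp// => /ltW.
  (* Time 0 is removed from the interval because the bound on [m(P_s A)] is given for [s > 0] only;
     a point does not affect the integral. *)
  have <- : \int[leb]_(s in `]0%R, n.+1%:R]) (\int[m]_x Pt P s (fun y => (\1_A y)%:E) x) =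
      \int[leb]_(s in `[0%R, n.+1%:R]) (\int[m]_x Pt P s (fun y => (\1_A y)%:E) x).
    rewrite -(normE false) -(normE true); apply: integral_itv_obnd_cbnd.
    exact: measurable_funTS.
  rewrite [leRHS](_ : _ = (n.+1%:R^-1)%:E * (n.+1%:R%:E * (delta * c + phi A)%:E)); last first.
    by rewrite -!EFinM mulKf ?pnatr_eq0.
  apply: lee_wpmul2l; first by rewrite lee_fin invr_ge0.
  apply: (@le_trans _ _ (\int[leb]_(s in `]0%R, n.+1%:R]) (delta * c + phi A)%:E)).
    apply: ge0_le_integral => //.
    - by move=> s _; apply: integral_ge0 => x _; exact: Pt_ge0.
    - apply: (@eq_measurable_fun _ _ _ _ _ (fun s : R => \int[m]_x Pt P `|s|%R (fun y => (\1_A y)%:E) x)).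
        move=> s; rewrite inE/= in_itv/= => /andP[s0 _].
        by rewrite (gtr0_norm s0).
      exact: measurable_funTS.
    - move=> s; rewrite /= in_itv/= => /andP[s0 _].
      rewrite EFinD EFinM -mTE; apply: le_trans (am_le _ s0 _ mA).
      by rewrite (eq_integral (fun x => P s x A))// => x _; rewrite Pt_indic.
  by rewrite integral_cst//= lebesgue_measure_itv/= lte_fin ltr0Sn sube0 muleC.
have := eta0; rewrite /= => /eqP; rewrite eq_le => /andP[+ _].
move=> /le_lt_trans => /(_ e%:E); rewrite lte_fin => /(_ e0).
move=> /ereal_inf_lt[_ [F [mF TF] <-] Fe].
pose G n := \big[setU/set0]_(k < n) F k.
have mG n : measurable (G n) by apply: bigsetU_measurable => i _; exact: mF.
have mGC n : measurable (~` G n) by exact: measurableC.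
have : m (~` G n) @[n --> \oo] --> m (\bigcap_n (~` G n)).
  apply: (@nonincreasing_cvg_mu _ _ _ m (fun n => ~` G n)) => //.
  - by rewrite ltey_eq fin_num_measure.
  - exact: bigcapT_measurable.
  - move=> i j ij; apply/subsetPset; apply: subsetC; exact: subset_bigsetU.
rewrite [X in m X](_ : _ = set0); last first.
  apply/seteqP; split => // x xG; have [k _ Fkx] := TF x I.
  by apply: (xG k.+1 I); rewrite /G -bigcup_mkord; exists k => //=.
rewrite measure0 => /fine_cvgP[fin /cvgrPdist_lt /(_ _ u0) small].
near \oo => n.
have mGn : m (~` G n) < u%:E.
  rewrite -(@fineK _ (m _)) ?fin_num_measure// lte_fin.
  rewrite -[ltLHS]ger0_norm ?fine_ge0// -normrN -sub0r; by near: n.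
have sub : cesaro_limit (G n) <= e%:E.
  apply: (le_trans _ (ltW Fe)).
  apply: (@le_trans _ _ (\sum_(k < n) cesaro_limit (F k))).
    by apply: content_subadditive => // k _; exact: mF.
  rewrite -(big_mkord xpredT (fun k => cesaro_limit (F k))).
  by apply: nneseries_lim_ge.
have : c%:E <= e%:E + (delta * c + phi (~` G n))%:E.
  rewrite -cesaro_limitT -(setUv (G n)) measureU//; last exact: setICr.
  by rewrite leeD// EFinD EFinM lim_le.
have := phi_e _ (mGC n) mGn.
rewrite -EFinD lee_fin /e; move: (phi _) => p; lra.
Unshelve. all: by end_near. Qed.

Lemma cesaro_core_invariant : invariant_measure P eta /\ eta `<< m.
Proof.
split; last exact: eta_dominated.
split; first exact: eta_fin.
by split; [exact: eta_neq0|move=> t t0 f mf fb; exact: (eta_invariant (ltW t0))].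
Qed.

End invariant.

Lemma almost_invariant_invariant_measure {R : realType} {E : ptopologicalType}
    (P : R -> borelE E -> probability (borelE E) R)
    (m : {finite_measure set (borelE E) -> \bar R}) :
  transition_function P -> almost_invariant P m -> m setT <> 0%E ->
  exists eta : {measure set (borelE E) -> \bar R}, invariant_measure P eta /\ eta `<< m.
Proof.
move=> hP am m0; have [U [UU Uoo]] := ultraFilterLemma (eventually_filter).
exists (cesaro_core hP m UU); exact: cesaro_core_invariant.
Qed.

Theorem theorem3p3 (R : realType) (E : ptopologicalType)
    (P : R -> borelE E -> probability (borelE E) R)
    (K : set (borelE E)) (nu : probability (borelE E) R)
    (tn : nat -> R) (nk : nat -> nat)
    (mu : {finite_measure set (borelE E) -> \bar R}) (alpha : R) :
  polish R E ->
  transition_function P ->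
  feller P ->
  compact (K : set E) ->
  (limf_esup (fun t : R => muK P nu K t (fun _ => 1%E)) +oo%R > (2^-1)%:E)%E ->
  (forall n, 0 < tn n) -> nondecreasing_seq tn -> tn @ \oo --> +oo%R ->
  (forall n, (muK P nu K (tn n) (fun _ => 1%E) > (2^-1)%:E)%E) ->
  {homo nk : i j / (i < j)%N} ->
  (forall f : E -> R, continuous f -> (exists M : R, forall x, `|f x| <= M) ->
     (fun k => muK P nu K (tn (nk k)) (fun y => (f y)%:E)) @ \oo
       --> (\int[mu]_x (f x)%:E)%E) ->
  0 < alpha ->
  exists m : {measure set (borelE E) -> \bar R},
    (forall f : borelE E -> \bar R, measurable_fun setT f -> (forall x, 0 <= f x)%E ->
       (\int[m]_x f x = \int[mu]_x (alpha%:E * resolvent P alpha f x))%E) /\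
    almost_invariant P m /\
    exists eta : {measure set (borelE E) -> \bar R}, invariant_measure P eta /\ eta `<< m.

Proof.
move=> pE hP fP cK _ tn0 _ tny muK_half nk_incr muK_cvg alpha0.
have mK : measurable K.
  rewrite -[K]setCK; apply: measurableC; apply: sub_sigma_algebra.
  by apply: closed_openC; apply: compact_closed => //; exact: polish_hausdorff pE.
have nk_ge k : (k <= nk k)%N.
  by elim: k => // k ih; rewrite (leq_ltn_trans ih)// nk_incr.
have Ty : tn \o nk @ \oo --> +oo%R.
  apply/cvgryPge => A; move/cvgryPge : tny => /(_ A)[N _ NA].
  by exists N => // k /= Nk; apply: NA; rewrite /= (leq_trans Nk).
(* Weak convergence is tested on the constant 1; the strict bounds on the masses survive in the
   limit as a non-strict one. *)
have mu_half : ((2^-1)%:E <= mu setT)%E.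
  have c1 : continuous (cst 1 : E -> R) by move=> x; exact: cvg_cst.
  have b1 : exists M : R, forall x, `|(cst 1 : E -> R) x| <= M.
    by exists 1 => x; rewrite normr1.
  have <- : (\int[mu]_x ((cst 1 : E -> R) x)%:E)%E = mu setT.
    transitivity (1 * mu setT)%E; last by rewrite mul1e.
    exact: (integral_cst mu measurableT 1%E).
  apply: (cvge_to_ge (muK_cvg _ c1 b1)); by apply: nearW => k; apply: ltW; exact: muK_half.
have am : almost_invariant P (exponential_average hP alpha0 mu).
  apply: (exponential_average_almost_invariant pE) => //.
  exact: (weak_limit_partition hP fP mK (T := tn \o nk) (fun k => tn0 (nk k)) Ty muK_cvg).
exists (exponential_average hP alpha0 mu); split.
  by move=> f mf f0; exact: integral_exponential_average.
split; first exact: am.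
have m_fin : (exponential_average hP alpha0 mu setT < +oo)%E by case: am.
(* The existence lemma asks for a finite measure, and finiteness of [m] is the first clause of
   almost invariance. *)
apply: (@almost_invariant_invariant_measure _ _ _ (finite_measure_of m_fin) hP am).
rewrite /finite_measure_of exponential_average_setT => mu0.
by move: mu_half; rewrite mu0 lee_fin invr_le0 leNgt ltr0n.
Qed.
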